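(* For positive integers $k$ and $n$, the $n\times n$ Cartesian grid $G_n = P_n\,\square\,P_n$ satisfies \[ b_k(G_n) \leq \begin{cases} 2n - 2\lfloor \log_2(n+3)\rfloor + 2 & \text{for } k=1,\\[2pt] 2n - \frac{k}{2} - 2 & \text{for } 2 \leq k \leq \frac{n-3}{2},\\[2pt] \frac{7n}{4} - \frac{5}{4} & \text{for } \frac{n-3}{2} < k \leq \frac{4n}{7},\\[2pt] \frac{n^2}{k-2\sqrt{k}+1} + 2\sqrt{k} - 3 & \text{for } \frac{4n}{7} < k < \left(\frac{3}{16}\right)^{2/3} n^{4/3},\\[2pt] \frac{n^2}{k} + (1+o(1))\left(\frac{3}{2}\right)^{1/3} n^{2/3} & \text{for } k \geq \left(\frac{3}{16}\right)^{2/3} n^{4/3}, \end{cases} \] where $o(1)$ denotes a quantity tending to $0$ as $n\to\infty$.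
   Context: All graphs are finite, simple and undirected. $P_n$ is the path on $n$ vertices and $\square$ is the Cartesian product of graphs: $(u,v)$ and $(x,y)$ are adjacent iff $u=x$ and $vy$ is an edge, or $v=y$ and $ux$ is an edge. $k$-liminal burning game on $G$ ($k$ a positive integer): two players, Saboteur and Arsonist. Each vertex is burned or unburned, and revealed or unrevealed; initially all are unburned and unrevealed. In each round: (i) propagation: every unburned vertex with a neighbor burned in an earlier round becomes burned (whether revealed or not); (ii) the Saboteur reveals $k$ vertices that are unrevealed and unburned (all such vertices if fewer than $k$ exist); revealed vertices stay revealed; (iii) the Arsonist burns one revealed unburned vertex (revealed in this or any earlier round), if one exists. The game ends in the round in which all vertices are burned. The Saboteur maximizes and the Arsonist minimizes the number of rounds; $b_k(G)$ is the number of rounds under optimal play.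
   Formalization: The bound for k=1 is stated for all n except n=1 and n=5, where it is false: b_1(G_1)=1 exceeds the bound 0, and b_1(G_5) is at least 7 while the bound is 6. *)

(* Defs.v *)
From mathcomp Require Import all_boot.

Set Implicit Arguments.
Unset Strict Implicit.
Unset Printing Implicit Defensive.

Local Open Scope nat_scope.

Structure sgraph := SGraph {
  vertex :> finType;
  edge : rel vertex;
  edge_sym : symmetric edge;
  edge_irr : irreflexive edge }.

Section PathGraph.
Variable n : nat.

Definition path_edge : rel 'I_n := [rel i j : 'I_n | (i.+1 == j) || (j.+1 == i)].

Lemma path_edge_sym : symmetric path_edge.
Proof. by move=> i j; rewrite /path_edge /= orbC. Qed.

Lemma path_edge_irr : irreflexive path_edge.
Proof. by move=> i; rewrite /path_edge /= orbb gtn_eqF. Qed.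

Definition path_graph : sgraph := SGraph path_edge_sym path_edge_irr.

End PathGraph.

Section CartesianProduct.
Variables G H : sgraph.

Definition cart_edge : rel (G * H) := [rel p q |
  (p.1 == q.1) && edge p.2 q.2 || (p.2 == q.2) && edge p.1 q.1].

Lemma cart_edge_sym : symmetric cart_edge.
Proof.
move=> p q; rewrite /cart_edge /=.
by rewrite (eq_sym p.1) (eq_sym p.2) (edge_sym p.1) (edge_sym p.2).
Qed.

Lemma cart_edge_irr : irreflexive cart_edge.
Proof. by move=> p; rewrite /cart_edge /= !edge_irr !andbF. Qed.

Definition cart_prod : sgraph := SGraph cart_edge_sym cart_edge_irr.

End CartesianProduct.

Definition grid (n : nat) : sgraph := cart_prod (path_graph n) (path_graph n).

Lemma bigminn_le (I : finType) (P : pred I) (x : nat) (F : I -> nat) (j : I) :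
  P j -> \big[minn/x]_(i | P i) F i <= F j.
Proof.
move=> Pj; have := mem_index_enum j; elim: (index_enum I) => // a l IHl.
rewrite inE big_cons => /orP[/eqP <-|/IHl le_j]; first by rewrite Pj geq_minl.
by case: ifP => // _; apply: leq_trans (geq_minr _ _) le_j.
Qed.

Section LiminalBurning.
Variables (k : nat) (G : sgraph).
Implicit Types B Rv S : {set G}.

Definition propagate B : {set G} := B :|: [set v | [exists u in B, edge u v]].

Definition reveal_moves B Rv : {set {set G}} :=
  [set S : {set G} | (S \subset ~: (B :|: Rv)) && (#|S| == minn k #|~: (B :|: Rv)|)].

(* The burned sets that the Arsonist can produce; passing is allowed only when
   every revealed vertex is already burned. *)
Definition burn_moves B Rv : {set {set G}} :=
  if Rv \subset B then [set B] else [set v |: B | v in Rv :\: B].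

(* Minimax value (number of further rounds) of the position reached at the end
   of a round with burned set B and revealed set Rv.  The argument m only makes
   the recursion structural: for 0 < k every round burns a new vertex, so any
   m >= #|~: B| gives the same value (game_value_stable).  The neutral element
   #|G| of the minimum is never below an actual value (game_value_le), and
   burn_moves is never empty (burn_moves_neq0). *)
Fixpoint game_value (m : nat) B Rv : nat :=
  if m is m'.+1 then
    if B == [set: G] then 0 else
    let B1 := propagate B in
    (\max_(S in reveal_moves B1 Rv)
       \big[minn/#|G|]_(B2 in burn_moves B1 (Rv :|: S))
          game_value m' B2 (Rv :|: S)).+1
  else 0.

Definition liminal_burning_number : nat := game_value #|G| set0 set0.

Lemma burn_moves_neq0 B Rv : burn_moves B Rv != set0.
Proof.
rewrite /burn_moves; case: ifPn => [_|].
  by apply/set0Pn; exists B; rewrite inE.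
case/subsetPn => v vR vB; apply/set0Pn; exists (v |: B).
by apply/imsetP; exists v; rewrite ?inE ?vB.
Qed.

Lemma reveal_moves_neq0 B Rv : reveal_moves B Rv != set0.
Proof.
set U := ~: (B :|: Rv).
apply/set0Pn; exists [set x in take (minn k #|U|) (enum U)].
rewrite inE -/U; apply/andP; split.
  by apply/subsetP => x; rewrite inE => /mem_take; rewrite mem_enum.
rewrite cardsE (card_uniqP _) ?take_uniq ?enum_uniq // size_takel //.
by rewrite -cardE geq_minr.
Qed.

Lemma propagateS B : B \subset propagate B.
Proof. exact: subsetUl. Qed.

Lemma burn_moves_card B Rv S B2 : 0 < k -> B != [set: G] ->
  S \in reveal_moves (propagate B) Rv ->
  B2 \in burn_moves (propagate B) (Rv :|: S) -> #|~: B2| < #|~: B|.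
Proof.
move=> k_gt0 BT; rewrite inE => /andP[SU /eqP cS] B2in.
apply: proper_card; rewrite properC; move: B2in; rewrite /burn_moves.
case: ifPn => [RSB|_].
  rewrite inE => /eqP ->; rewrite properEneq propagateS andbT.
  apply: contraNneq BT => eB; rewrite -subTset.
  have U0 : ~: (propagate B :|: Rv) = set0.
    apply/eqP; rewrite -cards_eq0.
    have : S == set0.
      rewrite -subset0; apply/subsetP => x xS.
      move/subsetP: SU => /(_ _ xS); rewrite !inE negb_or => /andP[xB _].
      move/subsetP: RSB => /(_ x); rewrite !inE xS orbT => /(_ isT).
      by rewrite (negPf xB).
    rewrite -cards_eq0 cS; case: #|_| => // c.
    by rewrite -(prednK k_gt0) minnSS.
  apply/subsetP => x _.
  have : x \notin ~: (propagate B :|: Rv) by rewrite U0 inE.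
  rewrite inE negbK inE -eB => /orP[//|xR].
  by rewrite eB; apply: (subsetP RSB); rewrite inE xR.
case/imsetP => v; rewrite inE => /andP[vB _] ->.
apply/properP; split; first exact: subset_trans (propagateS B) (subsetUr _ _).
exists v; first by rewrite !inE eqxx.
by apply: contra vB; apply: (subsetP (propagateS B)).
Qed.

Lemma game_value_stable m m' B Rv : 0 < k ->
  #|~: B| <= m -> #|~: B| <= m' -> game_value m B Rv = game_value m' B Rv.
Proof.
move=> k_gt0.
have CT (A : {set G}) : (#|~: A| <= 0) = (A == [set: G]).
  rewrite leqn0 cards_eq0; apply/eqP/eqP => [/(congr1 (@setC G))|->].
    by rewrite setCK setC0.
  exact: setCT.
elim: m m' B Rv => [|m IHm] [|m'] B Rv //=; rewrite ?CT => Bm Bm'.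
- by rewrite Bm.
- by rewrite Bm'.
case: ifPn => // BT; congr (_.+1); apply: eq_bigr => S SU.
apply: eq_bigr => B2 B2in; have lt := burn_moves_card k_gt0 BT SU B2in.
by apply: IHm; rewrite -ltnS; apply: leq_trans lt _.
Qed.

Lemma game_value_le m B Rv : 0 < k -> game_value m B Rv <= #|~: B|.
Proof.
move=> k_gt0; elim: m B Rv => //= m IHm B Rv.
case: ifPn => // BT.
have B_gt0 : 0 < #|~: B|.
  rewrite lt0n cards_eq0; apply: contra BT => /eqP.
  by move/(congr1 (@setC G)); rewrite setCK setC0 => ->.
rewrite -(prednK B_gt0) ltnS; apply/bigmax_leqP => S SU.
have /set0Pn[B2 B2in] := burn_moves_neq0 (propagate B) (Rv :|: S).
apply: leq_trans (bigminn_le _ _ B2in) _.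
rewrite -ltnS (prednK B_gt0).
exact: leq_ltn_trans (IHm _ _) (burn_moves_card k_gt0 BT SU B2in).
Qed.

End LiminalBurning.

(* Main.v *)
Require Import Defs.
From mathcomp Require Import all_boot all_order all_algebra.
From mathcomp Require Import zify ring lra.

Set Implicit Arguments.
Unset Strict Implicit.
Unset Printing Implicit Defensive.

(* [k = 1].  Whatever the Arsonist does, a round turns the burned set [B] into at
   least [|N[B]| + 1] vertices.  A set of [a] vertices of the grid whose closed
   neighborhood has [a + d] vertices satisfies [d >= n], [a <= T(d - 1)] or
   [n^2 - a <= T(d)], where [T] denotes triangular numbers; iterating this gives
   the logarithmic term, one half of it before the middle of the grid is reached
   and the other half after it.

   [k] up to [4n/7].  For [k <= 5] or [n <= 12] the argument above suffices.
   Otherwise let [h] be the minimum of [k] and [n/2 - 1], rounded down.  After [h/2]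
   rounds more than [T(h - 2)] vertices are revealed.  If one of them is at distance
   at least [h - 2] from the nearest corner, the Arsonist burns it; the fire reaches
   the opposite corner about [h/2] rounds earlier than a fire started in a corner,
   and two more rounds are saved at the end because the last six vertices are
   revealed together.  If not, the revealed vertices are near two distinct corners,
   and fires at both of them are enough.

   [k] between [4n/7] and [(3/16)^(2/3) n^(4/3)].  The grid is cut into squares of
   side the ceiling of [sqrt k].  As a square has at least [k] vertices, the Arsonist
   can keep the number of squares containing a fire at least equal to the number of
   revealed vertices divided by the area of a square.  Once all vertices are
   revealed, the few squares left are burned at their centers, from where the fire
   needs only half the diameter of a square.

   Larger [k].  After [n^2 / k] rounds all vertices are revealed and what remains
   is the burning number of the grid, estimated by covering horizontal strips with
   diamonds of almost equal radii. *)

(** * Strategies of the Arsonist in an arbitrary graph *)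

Section Game.
Local Open Scope nat_scope.
Variables (k : nat) (G : sgraph).
Implicit Types B Rv S : {set G}.

(** The Arsonist can end the game within [j] more rounds. As a proposition it lets strategies be
    composed round by round, without minima and maxima. *)
Fixpoint win (j : nat) B Rv : Prop :=
  if j is i.+1 then
    B = [set: G] \/ forall S, S \in reveal_moves k (propagate B) Rv ->
      exists2 B2, B2 \in burn_moves (propagate B) (Rv :|: S) & win i B2 (Rv :|: S)
  else B = [set: G].

Lemma game_value_win m j B Rv : win j B Rv -> game_value k m B Rv <= j.
Proof.
elim: m j B Rv => [//|m IHm] [|j] B Rv /=; first by move->; rewrite eqxx.
case: ifPn => // BT [BE|wS]; first by rewrite BE eqxx in BT.
rewrite ltnS; apply/bigmax_leqP => S /wS[B2 B2in w2].
exact: leq_trans (bigminn_le _ _ B2in) (IHm _ _ _ w2).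
Qed.

(* The second case occurs once fewer than [k] vertices were left to reveal. *)
Definition known B Rv (q : nat) : Prop := q <= #|Rv| \/ B :|: Rv = [set: G].

Lemma burn_moves_sub B Rv B2 : B2 \in burn_moves B Rv -> B \subset B2.
Proof.
rewrite /burn_moves; case: ifP => _; first by rewrite inE => /eqP ->.
by case/imsetP => v _ ->; apply: subsetUr.
Qed.

Lemma burn_moves_mem B Rv x : x \in B :|: Rv ->
  exists2 B2, B2 \in burn_moves B Rv & x \in B2.
Proof.
have [xB _|xB] := boolP (x \in B).
  have /set0Pn[B2 B2in] := burn_moves_neq0 B Rv.
  by exists B2 => //; apply: (subsetP (burn_moves_sub B2in)).
rewrite inE (negPf xB) /= => xR; exists (x |: B); last by rewrite !inE eqxx.
rewrite /burn_moves; case: ifPn => [/subsetP/(_ _ xR)|_].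
  by rewrite (negPf xB).
by apply/imsetP; exists x; rewrite ?inE ?xB.
Qed.

Lemma known_reveal B Rv S q : S \in reveal_moves k (propagate B) Rv ->
  known B Rv q -> known (propagate B) (Rv :|: S) (q + k).
Proof.
rewrite inE => /andP[SU /eqP cS] [qR|BR]; last first.
  right; apply/eqP; rewrite -subTset -BR setUA.
  exact: subset_trans (setSU _ (propagateS _)) (subsetUl _ _).
have [kU|Uk] := leqP k #|~: (propagate B :|: Rv)|.
  left; rewrite cardsU cS (minn_idPl kU).
  suff -> : Rv :&: S = set0 by rewrite cards0 subn0 leq_add2r.
  apply/setP => x; rewrite !inE; apply/negbTE/andP => -[xR xS].
  by move/subsetP/(_ _ xS): SU; rewrite !inE xR orbT.
right; have SE : S = ~: (propagate B :|: Rv).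
  by apply/eqP; rewrite eqEcard SU cS (minn_idPr (ltnW Uk)) leqnn.
by rewrite setUA SE setUCr.
Qed.

Lemma known_sub B B' Rv q : B \subset B' -> known B Rv q -> known B' Rv q.
Proof.
move=> BB' [|BR]; [by left | right]; apply/eqP.
by rewrite -subTset -BR setSU.
Qed.

Lemma propagate_mono B B' : B \subset B' -> propagate B \subset propagate B'.
Proof.
move=> /subsetP BB'; apply/subsetP => v; rewrite !inE.
case/orP => [/BB' ->//|/existsP[u /andP[uB uv]]].
by apply/orP; right; apply/existsP; exists u; rewrite BB'.
Qed.

Lemma iter_propagate_mono j B B' : B \subset B' ->
  iter j (@propagate G) B \subset iter j (@propagate G) B'.
Proof. by elim: j => //= j IHj /IHj; apply: propagate_mono. Qed.

Lemma iter_propagate_mem j B u z : u \in B ->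
  z \in iter j (@propagate G) [set u] -> z \in iter j (@propagate G) B.
Proof. by move=> uB; apply/subsetP/iter_propagate_mono; rewrite sub1set. Qed.

Lemma iter_propagateSr j B B2 Rv : B2 \in burn_moves (propagate B) Rv ->
  iter j.+1 (@propagate G) B \subset iter j (@propagate G) B2.
Proof.
by move=> B2in; rewrite iterSr iter_propagate_mono ?(burn_moves_sub B2in).
Qed.

Lemma iter_propagate_leq i j B : i <= j ->
  iter i (@propagate G) B \subset iter j (@propagate G) B.
Proof.
move=> /subnK <-; elim: (j - i) => // d IHd.
exact: subset_trans IHd (propagateS _).
Qed.

(** For [i] rounds the Arsonist makes arbitrary legal moves; only the spread of the old fire and the
    number of revealed vertices are recorded. *)
Lemma win_wait i j B Rv q : known B Rv q ->
  (forall B' Rv', iter i (@propagate G) B \subset B' ->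
     known B' Rv' (q + i * k) -> win j B' Rv') ->
  win (i + j) B Rv.
Proof.
elim: i B Rv q => [|i IHi] B Rv q knB wB.
  by apply: wB => //; rewrite mul0n addn0.
right=> S Sin; have /set0Pn[B2 B2in] := burn_moves_neq0 (propagate B) (Rv :|: S).
exists B2 => //; apply: (IHi _ _ (q + k)) => [|B' Rv' sB' kn'].
  exact: known_sub (burn_moves_sub B2in) (known_reveal Sin knB).
apply: wB; last by rewrite mulSn addnA.
exact: subset_trans (iter_propagateSr i B2in) sB'.
Qed.

Lemma win_passive j B Rv : iter j (@propagate G) B = [set: G] -> win j B Rv.
Proof.
move=> BT; rewrite -[j]addn0; apply: (@win_wait _ _ _ _ 0) => [|B' Rv']; first by left.
by rewrite BT subTset => /eqP.
Qed.

(** The target [x] may be burned already; then any legal move serves. *)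
Lemma win_step j B Rv q :
  known B Rv q ->
  (forall Rv', known (propagate B) Rv' (q + k) ->
     exists2 x, x \in propagate B :|: Rv' &
       forall B2, x \in B2 -> propagate B \subset B2 ->
         known B2 Rv' (q + k) -> win j B2 Rv') ->
  win j.+1 B Rv.
Proof.
move=> knB wB; right=> S Sin; have kn' := known_reveal Sin knB.
have [x xin wx] := wB _ kn'; have [B2 B2in xB2] := burn_moves_mem xin.
exists B2 => //; apply: wx => //; first exact: burn_moves_sub B2in.
exact: known_sub (burn_moves_sub B2in) kn'.
Qed.

(* Once everything is revealed, the Arsonist burns [f j], ..., [f 1], [f 0] in
   the last rounds; the fire started at [f i] still spreads for [i] rounds. *)
Lemma win_burn_sequence j B Rv q (f : nat -> G) :
  known B Rv q -> #|G| <= q + k ->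
  (forall z, z \in iter j (@propagate G) B \/
     exists2 i, i < j & z \in iter i (@propagate G) [set f i]) ->
  win j B Rv.
Proof.
elim: j B Rv q => [|j IHj] B Rv q knB Gq cov.
  apply/setP => z; rewrite inE; case: (cov z) => [//|[i]]; by rewrite ltn0.
apply: (win_step knB) => Rv' kn'; exists (f j).
  case: kn' => [cR|->]; last by rewrite inE.
  rewrite inE; apply/orP; right.
  have /eqP -> : Rv' == [set: G] by rewrite eqEcard subsetT cardsT (leq_trans Gq).
  by rewrite inE.
move=> B2 fB2 sB2 kn2; apply: (IHj _ _ _ kn2) => [|z].
  exact: leq_trans Gq (leq_addr _ _).
case: (cov z) => [zB|[i ij zi]].
  left; move: zB; rewrite iterSr; exact/subsetP/iter_propagate_mono.
have [lt_ij|] := ltnP i j; first by right; exists i.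
move=> ji; have ei : i = j by lia.
by left; apply: (iter_propagate_mem fB2); rewrite -{1}ei -ei.
Qed.

End Game.

(** * Distances and balls in the grid *)

Section GridMetric.
Local Open Scope nat_scope.
Variable n : nat.
Implicit Types u z : grid n.

Definition row_of z : nat := nat_of_ord z.1.
Definition col_of z : nat := nat_of_ord z.2.

Lemma row_of_lt z : row_of z < n. Proof. exact: ltn_ord. Qed.
Lemma col_of_lt z : col_of z < n. Proof. exact: ltn_ord. Qed.

Lemma coord_inj u z : row_of u = row_of z -> col_of u = col_of z -> u = z.
Proof.
by case: u z => [a b] [c d]; rewrite /row_of /col_of /= => /val_inj -> /val_inj ->.
Qed.

Lemma grid_point a b : a < n -> b < n -> exists z, row_of z = a /\ col_of z = b.
Proof. by move=> an bn; exists (Ordinal an, Ordinal bn). Qed.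

Definition adist (a b : nat) : nat := (a - b) + (b - a).

Definition gdist u z : nat :=
  adist (row_of u) (row_of z) + adist (col_of u) (col_of z).

Lemma grid_edgeE u z : edge u z = (gdist u z == 1).
Proof.
case: u z => [a b] [c d]; rewrite /gdist /adist /row_of /col_of /edge /= /cart_edge /=.
rewrite /edge /= /path_edge /= -!val_eqE /=; lia.
Qed.

Lemma mem_ball j u z : gdist u z <= j -> z \in iter j (@propagate (grid n)) [set u].
Proof.
elim: j z => [|j IHj] z /= duz.
  by rewrite inE; apply/eqP/coord_inj; move: duz; rewrite /gdist /adist; lia.
have [dj|dj] := leqP (gdist u z) j; first by rewrite inE IHj.
(* The vertex before [z] on a shortest path from [u]: one step back in the row coordinate if it
   differs, otherwise in the column coordinate. *)
have [z' dz' ez'] : exists2 z', gdist u z' <= j & edge z' z.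
  have [rz cz] := (row_of_lt z, col_of_lt z).
  have [ru cu] := (row_of_lt u, col_of_lt u).
  move: dj duz; rewrite /gdist /adist => dj duz.
  suff [a [b [an bn duab dabz]]] : exists a b, [/\ a < n, b < n,
      (row_of u - a) + (a - row_of u) + ((col_of u - b) + (b - col_of u)) <= j &
      (a - row_of z) + (row_of z - a) + ((b - col_of z) + (col_of z - b)) = 1].
    have [z' [ra cb]] := grid_point an bn.
    by exists z'; [rewrite /gdist /adist ra cb | rewrite grid_edgeE /gdist ra cb dabz].
  have [lt_uz|lt_zu|eq_uz] := ltngtP (row_of u) (row_of z).
  - by exists (row_of z).-1, (col_of z); split; lia.
  - by exists (row_of z).+1, (col_of z); split; lia.
  have [ltc|ltc] := ltnP (col_of u) (col_of z).
  - by exists (row_of z), (col_of z).-1; split; lia.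
  by exists (row_of z), (col_of z).+1; split; lia.
rewrite !inE; apply/orP; right; apply/existsP; exists z'.
by rewrite ez' IHj.
Qed.

Lemma card_grid : #|grid n| = n * n.
Proof. by rewrite card_prod card_ord. Qed.

End GridMetric.

(** * Vertex isoperimetry in the grid *)

Section Isoperimetry.
Local Open Scope nat_scope.

Definition tri r : nat := 'C(r.+1, 2).

Lemma tri0 : tri 0 = 0. Proof. by []. Qed.

Lemma triS r : tri r.+1 = tri r + r.+1.
Proof. by rewrite /tri binS bin1. Qed.

Lemma tri_leq r s : r <= s -> tri r <= tri s.
Proof. by move/subnK <-; elim: (s - r) => // d /leq_trans; apply; rewrite addSn triS leq_addr. Qed.

Lemma tri_double r : 2 * tri r = r * r.+1.
Proof. by elim: r => // r IHr; rewrite triS; lia. Qed.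

Lemma sum_subn_tri m r : \sum_(j < m) (r - j) <= tri r.
Proof.
elim: m r => [|m IHm] r; first by rewrite big_ord0.
rewrite big_ord_recl subn0; case: r => [|r]; first by rewrite big1.
rewrite triS addnC leq_add2r; apply: leq_trans (IHm r).
by apply: leq_sum => i _; rewrite subSS.
Qed.

Lemma sum_subn_rev_tri m r : \sum_(j < m) (r - (m - j.+1)) <= tri r.
Proof.
apply: leq_trans (sum_subn_tri m r); rewrite (reindex_inj rev_ord_inj) /=.
by apply: leq_sum => i _; have := ltn_ord i; lia.
Qed.

(** * Growth of Young diagrams in a square box *)

Section Profile.
Variables (n : nat) (c : nat -> nat).
Hypothesis c_mono : forall j, c j.+1 <= c j.
Hypothesis c_le : forall j, c j <= n.

(** The least size of the closed neighborhood of [a] vertices of a path on [n] vertices. *)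
Definition fat (a : nat) : nat := if a == 0 then 0 else minn n a.+1.

(* [c] is the list of column heights of a Young diagram in the [n * n] box and
   [profile] bounds from below those of its closed neighborhood. *)
Definition profile j : nat := maxn (fat (c j)) (if j is i.+1 then c i else 0).

Let gap j := profile j - c j.

Lemma profile_ge j : c j <= profile j.
Proof.
by rewrite /profile /fat; have := c_le j; case: eqP => [->|]; lia.
Qed.

Lemma gap_pos j : 0 < c j < n -> 0 < gap j.
Proof. by rewrite /gap /profile /fat => cj; case: eqP => ?; lia. Qed.

Lemma gap_sum_count i m : i <= m -> (forall j, i <= j < m -> 0 < c j < n) ->
  m - i <= \sum_(i <= j < m) gap j.
Proof.
move=> im cjn; have -> : m - i = \sum_(i <= j < m) 1 by rewrite sum_nat_const_nat muln1.
rewrite big_nat_cond [leqRHS]big_nat_cond; apply: leq_sum => j /andP[ijm _].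
exact/gap_pos/cjn.
Qed.

Lemma gap_sum_telescope i m : i <= m -> c i <= c m + \sum_(i.+1 <= j < m.+1) gap j.
Proof.
move/subnK <-; elim: (m - i) => [|d IHd]; first by rewrite big_geq // addn0.
rewrite addSn big_nat_recr /=; last by lia.
have : c (d + i) <= c (d + i).+1 + gap (d + i).+1 by rewrite /gap /profile; lia.
by move: IHd; lia.
Qed.

Lemma c_anti i j : i <= j -> c j <= c i.
Proof. by move/subnK <-; elim: (j - i) => // d /(leq_trans _); apply; rewrite addSn. Qed.

(** The gaps sum to at most [d]. A column neither empty nor full has a positive gap, and the gaps
    between two columns are at least the drop in height. If column 0 is not full and the last is
    empty, the gaps up to a nonempty column [i] take [i.+1] and the later ones [c i], so
    [c i <= d.-1 - i]. If column 0 is full and the last is not empty, the same holds for the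
    complement. In the two mixed cases the gaps sum to at least [n]. *)
Lemma profile_bound d : 0 < n -> 0 < c 0 ->
  \sum_(j < n) profile j <= \sum_(j < n) c j + d ->
  [\/ n <= d, \sum_(j < n) c j <= tri d.-1 | n * n <= \sum_(j < n) c j + tri d].
Proof.
move=> n_gt0 c0_gt0 sumd.
have gapd : \sum_(0 <= j < n) gap j <= d.
  rewrite big_mkord -(leq_add2l (\sum_(j < n) c j)) -big_split /=.
  by under eq_bigr => j _ do rewrite subnKC ?profile_ge //.
have split_gap i : i < n -> \sum_(0 <= j < n) gap j =
    \sum_(0 <= j < i.+1) gap j + \sum_(i.+1 <= j < n) gap j.
  by move=> lt_in; rewrite -big_cat_nat.
have tele0 i : i < n -> c 0 <= c i + \sum_(0 <= j < i.+1) gap j.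
  move=> lt_in; apply: leq_trans (gap_sum_telescope (leq0n i)) _.
  by rewrite leq_add2l [leqRHS]big_ltn // leq_addl.
have tele1 i : i < n -> c i <= c n.-1 + \sum_(i.+1 <= j < n) gap j.
  move=> lt_in; have := @gap_sum_telescope i n.-1; rewrite prednK //.
  by apply; lia.
have [c0n|c0n] := ltnP (c 0) n; have [cn0|cn0] := posnP (c n.-1).
- apply: Or32; apply: leq_trans (sum_subn_tri n d.-1); apply: leq_sum => i _.
  have [->//|ci_gt0] := posnP (c i); have i_lt := ltn_ord i.
  have := @gap_sum_count 0 i.+1 isT; rewrite subn0.
  have := tele1 _ i_lt; have := split_gap _ i_lt; rewrite cn0.
  move=> s1 s2 s3; suff : i < \sum_(0 <= j < i.+1) gap j by lia.
  apply: s3 => j /andP[_ ji]; have := c_anti (leq0n j); have := @c_anti j i.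
  by lia.
- apply: Or31; apply: leq_trans gapd; rewrite -{1}[n]subn0.
  apply: gap_sum_count => // j /andP[_ jn].
  by have := c_anti (leq0n j); have := @c_anti j n.-1; lia.
- by apply: Or31; have := tele1 0 n_gt0; have := split_gap 0 n_gt0; lia.
apply: Or33.
have -> : n * n = \sum_(j < n) c j + \sum_(j < n) (n - c j).
  rewrite -big_split /=; under eq_bigr => j _ do rewrite subnKC //.
  by rewrite sum_nat_const card_ord.
rewrite leq_add2l; apply: leq_trans (sum_subn_rev_tri n d); apply: leq_sum => i _.
have [|cin] := leqP n (c i); first by lia.
have i_lt := ltn_ord i.
have := tele0 _ i_lt; have := split_gap _ i_lt.
have := @gap_sum_count i.+1 n i_lt => s1 s2 s3.
suff : n - i.+1 <= \sum_(i.+1 <= j < n) gap j by lia.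
apply: s1 => j /andP[ij jn]; have := @c_anti j n.-1; have := @c_anti i j; lia.
Qed.

End Profile.

(** A nonempty set that does not grow is closed under adjacency, hence is the whole path. *)
Lemma path_neighborhood n (C : {set path_graph n}) :
  fat n #|C| <= #|propagate C|.
Proof.
rewrite /fat; case: eqP => // /eqP; rewrite cards_eq0 => /set0Pn[x xC].
have [ltC|] := ltnP #|C| #|propagate C|; first by rewrite geq_min ltC orbT.
move=> leC; have fixC : propagate C = C.
  by apply/eqP; rewrite eq_sym eqEcard propagateS.
suff CT : C = setT by rewrite fixC geq_min CT cardsT card_ord leqnn.
have closedC u v : u \in C -> edge u v -> v \in C.
  move=> uC uv; rewrite -fixC !inE; apply/orP; right.
  by apply/existsP; exists u; rewrite uC.
have all_d d : forall y : path_graph n, (y - x) + (x - y) <= d -> y \in C.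
  elim: d => [|d IHd] y dy; first by rewrite (_ : y = x) //; apply: val_inj => /=; lia.
  have [lt_xy|lt_yx|/val_inj <- //] := ltngtP x y.
    have y1 : y.-1 < n by have := ltn_ord y; lia.
    apply: (closedC (Ordinal y1)); first by apply: IHd => /=; lia.
    by rewrite /edge /= /path_edge /=; lia.
  have y1 : y.+1 < n by have := ltn_ord x; lia.
  apply: (closedC (Ordinal y1)); first by apply: IHd => /=; lia.
  by rewrite /edge /= /path_edge /=; lia.
by apply/setP => y; rewrite inE (all_d _ y (leqnn _)).
Qed.

(** * Compression of a set of grid vertices along its rows *)

Section GridRows.
Variable n : nat.
Implicit Type A : {set grid n}.

Definition row_set A (i : path_graph n) : {set path_graph n} := [set y | (i, y) \in A].
(** Pushing every row of [A] to one side and sorting the rows gives a Young diagram; [#|level A j|]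
    is the height of its column [j]. *)
Definition level A j : {set path_graph n} := [set i | j < #|row_set A i|].

Lemma card_levels A : #|A| = \sum_(j < n) #|level A j|.
Proof.
have -> : #|A| = \sum_i #|row_set A i|.
  rewrite -sum1_card (eq_bigr (fun i => \sum_(y | (i, y) \in A) 1)); last first.
    by move=> i _; rewrite -sum1_card; apply: eq_bigl => y; rewrite inE.
  by rewrite pair_big_dep /=; apply: eq_bigl => -[].
under [RHS]eq_bigr => j _ do rewrite -sum1_card big_mkcond /=.
rewrite exchange_big /=; apply: eq_bigr => i _.
have := max_card (mem (row_set A i)); rewrite card_ord => le_n.
under eq_bigr => j _ do rewrite inE.
rewrite -big_mkcond /= -(big_ord_widen _ (fun=> 1) le_n).
by rewrite sum_nat_const card_ord muln1.
Qed.

Lemma row_set_propagate A i : propagate (row_set A i) \subset row_set (propagate A) i.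
Proof.
apply/subsetP => y; rewrite !inE => /orP[->//|/existsP[z /andP[zA zy]]].
apply/orP; right; apply/existsP; exists (i, z); rewrite inE in zA.
by rewrite zA; apply/orP; left; apply/andP; split; [apply: eqxx | apply: zy].
Qed.

Lemma row_set_shift A i i' : edge i i' -> row_set A i \subset row_set (propagate A) i'.
Proof.
move=> ii'; apply/subsetP => y; rewrite !inE => yA.
apply/orP; right; apply/existsP; exists (i, y).
by rewrite yA; apply/orP; right; apply/andP; split; [apply: eqxx | apply: ii'].
Qed.

Lemma level_propagate A j : propagate (level A j) \subset level (propagate A) j.
Proof.
apply/subsetP => i; rewrite !inE => /orP[ji|/existsP[i' /andP[]]].
  apply: leq_trans ji (subset_leq_card _).
  exact: subset_trans (propagateS _) (row_set_propagate _ _).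
rewrite inE => ji ii'; have sA := row_set_shift A ii'.
exact: leq_trans ji (subset_leq_card sA).
Qed.

Lemma level_shift A j : j.+1 < n -> level A j \subset level (propagate A) j.+1.
Proof.
move=> jn; apply/subsetP => i; rewrite !inE => ji.
apply: leq_trans (subset_leq_card (row_set_propagate A i)).
apply: leq_trans (path_neighborhood (row_set A i)).
by rewrite /fat; case: eqP ji => [->//|_ ji]; rewrite leq_min jn.
Qed.

(** Spreading between rows enlarges each level as a subset of a path; spreading inside rows moves
    level [j] into level [j.+1]. These are the two terms of [profile]. *)
Lemma grid_isoperimetry A d : A != set0 -> #|propagate A| <= #|A| + d ->
  [\/ n <= d, #|A| <= tri d.-1 | n * n <= #|A| + tri d].
Proof.
move=> A0 Ad; set c := fun j => #|level A j|.
have card_le j : c j <= n by rewrite (leq_trans (max_card _)) ?card_ord.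
have [[x y] xyA] := set0Pn _ A0.
have n_gt0 : 0 < n by case: (n) x {A A0 Ad c card_le y xyA} => // -[].
have c_mono j : c j.+1 <= c j.
  by apply: subset_leq_card; apply/subsetP => i; rewrite !inE; apply: ltnW.
have c0 : 0 < c 0.
  apply/card_gt0P; exists x; rewrite inE; apply/card_gt0P; exists y.
  by rewrite inE.
rewrite card_levels; apply: (profile_bound c_mono) => //.
rewrite -(card_levels A); apply: leq_trans Ad; rewrite card_levels.
apply: leq_sum => j _; rewrite /profile geq_max; apply/andP; split.
  apply: leq_trans (path_neighborhood _) _.
  exact: subset_leq_card (level_propagate _ _).
case: j => -[|j] jn //=; exact: subset_leq_card (level_shift _ jn).
Qed.

End GridRows.
End Isoperimetry.

(** * Bounds from the number of burned vertices alone *)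

Section Cooling.
Local Open Scope nat_scope.

Lemma win_leq k (G : sgraph) i j (B Rv : {set G}) : i <= j -> win k i B Rv -> win k j B Rv.
Proof.
move/subnK <-; elim: (j - i) => // d IHd wi; rewrite addSn; move: (IHd wi).
elim: (d + i) B Rv {wi IHd} => [|m IHm] B Rv /=; first by left.
case=> [->|wm]; [by left | right=> S /wm[B2 B2in w2]].
by exists B2 => //; apply: IHm.
Qed.

(** The Arsonist passes only if all revealed vertices are burned; as [k > 0], nothing was left to
    reveal then, and everything is burned. *)
Lemma burn_moves_grow k (G : sgraph) (B Rv S B2 : {set G}) : 0 < k ->
  S \in reveal_moves k B Rv -> B2 \in burn_moves B (Rv :|: S) ->
  minn #|G| #|B|.+1 <= #|B2|.
Proof.
move=> k_gt0 Sin B2in; have sBB2 := burn_moves_sub B2in.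
have [BB2|] := ltnP #|B| #|B2|; first by rewrite geq_min BB2 orbT.
move=> leB; have eB : B2 = B by apply/eqP; rewrite eq_sym eqEcard sBB2.
rewrite geq_min eB -cardsT subset_leq_card // subTset.
move: B2in; rewrite eB /burn_moves; case: ifPn => [RSB _|_ /imsetP[v]]; last first.
  rewrite inE => /andP[vB _] eBv.
  by move: vB; rewrite eBv !inE eqxx.
move: Sin; rewrite inE => /andP[SU /eqP cS].
have S0 : S = set0.
  apply/setP => x; rewrite inE; apply/negP => xS.
  move/subsetP/(_ _ xS): SU; move/subsetP/(_ x): RSB; rewrite !inE xS orbT.
  by move=> ->.
move: cS; rewrite S0 cards0 => /esym/eqP; rewrite -leqn0 geq_min leqn0.
rewrite (gtn_eqF k_gt0) leqn0 cards_eq0 /= => /eqP U0.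
rewrite -subTset -[setT](setUCr (B :|: Rv)) U0 setU0 subUset subxx /=.
exact: subset_trans (subsetUl _ _) RSB.
Qed.

Lemma expn2_ge l : 1 < l -> l.+2 <= 2 ^ l.
Proof. by elim: l => // -[|[|m]] // IHm _; rewrite expnS; have := IHm isT; lia. Qed.

Lemma expn2_gt l : 1 < l -> l <> 2 -> l.+2 < 2 ^ l.
Proof.
case: l => // l l_gt0 l2; have l_gt1 : 1 < l by lia.
by rewrite expnS; have := expn2_ge l_gt1; lia.
Qed.

Variables (n k : nat).
Hypothesis k_gt0 : 0 < k.

Definition size_win j a : Prop :=
  forall B Rv : {set grid n}, minn (n * n) a <= #|B| -> win k j B Rv.

Lemma size_win_leq i j a b : i <= j -> b <= a -> size_win i b -> size_win j a.
Proof. by move=> ij ba wb B Rv aB; apply: win_leq ij (wb _ _ _); lia. Qed.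

Lemma size_win0 a : n * n <= a -> size_win 0 a.
Proof.
move=> na B Rv; rewrite (minn_idPl na) => nB; apply/eqP.
by rewrite eqEcard subsetT cardsT card_grid.
Qed.

(** In the hypothesis [x] vertices are burned, propagation adds [d], and the Arsonist adds the last
    one. *)
Lemma size_win_step j a b : 0 < a ->
  (forall x d, a <= x ->
     [\/ n <= d, x <= tri d.-1 | n * n <= x + tri d] ->
     minn (n * n) b <= (x + d).+1) ->
  size_win j b -> size_win j.+1 a.
Proof.
move=> a_gt0 step wb B Rv aB.
have [->|B0] := eqVneq B setT; first by left.
right=> S Sin; have /set0Pn[B2 B2in] := burn_moves_neq0 (propagate B) (Rv :|: S).
exists B2 => //; apply: wb; have := burn_moves_grow k_gt0 Sin B2in.
have ltB : #|B| < n * n by rewrite -card_grid -cardsT proper_card // properT.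
have Ba : a <= #|B| by lia.
have BN0 : B != set0 by rewrite -card_gt0; lia.
have sB := subset_leq_card (propagateS B).
have /(grid_isoperimetry BN0)/step -/(_ Ba) : #|propagate B| <= #|B| + (#|propagate B| - #|B|).
  by lia.
by rewrite card_grid; lia.
Qed.

Lemma size_win_start j : 0 < n -> size_win j 1 -> size_win j.+1 0.
Proof.
move=> n_gt0 w1 B Rv _; right=> S Sin.
have /set0Pn[B2 B2in] := burn_moves_neq0 (propagate B) (Rv :|: S).
exists B2 => //; apply: w1; apply: leq_trans (burn_moves_grow k_gt0 Sin B2in).
by rewrite card_grid; lia.
Qed.

Lemma tri_grid : n * n = tri n + tri n.-1.
Proof.
by case: (n) => [|m]; rewrite ?succnK; [|have := tri_double m; rewrite triS; lia].
Qed.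

(** Before the main antidiagonal, more than [tri s] burned vertices force [d >= s.+2]. The next two
    lemmas are the analogues at the antidiagonal, where [d >= n], and beyond it, where more than
    [tri r] unburned vertices force [d >= r.+1]. *)
Lemma size_win_grow1 j s x : s.+2 <= n -> tri s < x <= tri s.+1 ->
  size_win j (x + s.+3) -> size_win j.+1 x.
Proof.
rewrite triS => sn xs; apply: size_win_step; first by lia.
move=> y d xy; have := tri_grid; have := @tri_leq s.+2 n sn; rewrite 2!triS.
have := @tri_leq s.+1 n.-1; rewrite triS.
have [ds|sd] := leqP d s.+1; last by lia.
have := @tri_leq d.-1 s; have := @tri_leq d s.+1 ds; rewrite triS.
by move=> ? ? ? ? ? [] ?; lia.
Qed.

Lemma size_win_grow2 j s : 0 < s < n ->
  size_win j (tri n + s.+1) -> size_win j.+1 (tri n.-1 + s).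
Proof.
move=> sn; apply: size_win_step; first by lia.
have -> : tri n = tri n.-1 + n by case: (n) sn => [|m _]; rewrite ?triS //; lia.
move=> y d xy; have [ds|sd] := ltnP d n; last by lia.
have := tri_grid; have -> : tri n = tri n.-1 + n.
  by case: (n) sn => [|m _]; rewrite ?triS //; lia.
have := @tri_leq d n.-1; have := @tri_leq d.-1 n.-1.
case: d ds => [|d] ds; first by rewrite !tri0; move=> ? ? ? [] ?; lia.
have [m en] : exists m, n = m.+2 by exists n.-2; lia.
move: xy; have := @tri_leq d m; rewrite en !succnK !triS.
by move=> ? ? ? ? ? [] ?; lia.
Qed.

Lemma size_win_grow3 j r e : 1 < n -> r < n -> tri r < e <= tri n ->
  size_win j (n * n - (e - r.+2)) -> size_win j.+1 (n * n - e).
Proof.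
move=> n_gt1 rn er; have [m en] : exists m, n = m.+2 by exists n.-2; lia.
have := tri_grid; rewrite {3 4}en succnK !triS => nn.
have triE : tri n = tri m + m.+1 + m.+2 by rewrite en !triS.
apply: size_win_step; first by lia.
move=> y d yd; have [dr|rd] := leqP d r; last by lia.
have := @tri_leq d.-1 m; case: d dr => [|d] dr; first by rewrite !tri0; move=> ? [] ?; lia.
have := @tri_leq d r.-1; case: r rn er dr => // r rn er dr; rewrite succnK triS.
by move: er; rewrite triS => er ? ? [] ?; lia.
Qed.

(** The unburned part is a triangle of [r] diagonals minus a surplus of [6 * 2 ^ i - 1 - r]. A round
    clears [r + 1] vertices, one diagonal and one more, so the surplus grows by one. At
    [r = 3 * 2 ^ i] it suffices to skip a whole diagonal, which saves a round, and [i] decreases. *)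
Lemma size_win_finish i r e : 1 < n -> r <= n ->
  3 * 2 ^ i <= r <= 6 * 2 ^ i - 2 -> e + (6 * 2 ^ i - 1 - r) <= tri r ->
  size_win (r - i - 2) (n * n - e).
Proof.
move=> n_gt1; elim/ltn_ind: r i e => r IHr i e rn r_bnd e_bnd.
have i_lt : i < 2 ^ i by apply: ltn_expl.
have [e1 e1E] : exists e1, e1 = tri r - (6 * 2 ^ i - 1 - r) by eexists.
have le_e : e <= e1 by lia.
apply: (@size_win_leq (r - i - 2) _ _ (n * n - e1)) => //; first by lia.
have [s er] : exists s, r = s.+3 by exists (r - 3); lia.
have trin := tri_leq rn.
have -> : r - i - 2 = (r - i - 3).+1 by lia.
apply: (@size_win_grow3 _ s.+2) => //; first by lia.
  by move: trin e1E; rewrite er !triS; lia.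
have [lt_r|ge_r] := ltnP (3 * 2 ^ i) r.
  have -> : r - i - 3 = s.+2 - i - 2 by lia.
  apply: IHr; [by lia|by lia|by lia|].
  by move: trin e1E; rewrite er !triS; lia.
have r_eq : r = 3 * 2 ^ i by lia.
case: i IHr i_lt r_bnd e_bnd e1E ge_r r_eq =>
  [|i] IHr i_lt r_bnd e_bnd e1E ge_r r_eq; rewrite ?expn0 ?expnS in i_lt r_bnd e_bnd e1E r_eq *.
  have s0 : s = 0 by lia.
  by apply: size_win_leq (leq0n _) _ (size_win0 (leqnn _));
     move: e1E; rewrite er s0 !triS tri0; lia.
have -> : r - i.+1 - 3 = s.+1 - i - 2 by lia.
by apply: IHr; try lia; move: trin e1E; rewrite er !triS; lia.
Qed.

(* A burned triangle of [q - 2] diagonals with one vertex on the next diagonal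
   gains one diagonal per round and two more vertices on the following one; when
   [q] is a power of two the excess fills a whole diagonal at the next one. *)
Lemma size_win_block j q t : 3 < q -> (q + t).-1 <= n -> t <= q - 2 ->
  size_win j (tri (q - 2 + t) + t.*2.+1) -> size_win (j + t.+1) (tri (q - 3)).
Proof.
move=> q_gt3; elim: t j => [|t IHt] j qtn tq wj.
  have [s eq_s] : exists s, q = s.+4 by exists (q - 4); lia.
  rewrite addn1; apply: (@size_win_grow1 _ s); [by lia| |].
    by rewrite eq_s !triS; lia.
  apply: size_win_leq wj => //; rewrite eq_s addn0 (_ : s.+4 - 2 = s.+2); last by lia.
  by rewrite (_ : s.+4 - 3 = s.+1) ?triS; lia.
have -> : j + t.+2 = j.+1 + t.+1 by lia.
apply: IHt; [by lia|by lia|].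
apply: (@size_win_grow1 _ (q - 2 + t)); [by lia|by rewrite triS; lia|].
apply: size_win_leq wj => //.
by rewrite (addnS (q - 2) t) triS; lia.
Qed.

(** Each doubling of [q] in [size_win_block] saves one round, which yields the term [m]. *)
Lemma size_win_reach m j : 1 < m -> 2 ^ m - 3 <= n ->
  size_win j (tri (2 ^ m - 3)) -> size_win (j + (2 ^ m - m - 2)) 1.
Proof.
elim: m j => // -[|[|m]] IHm j // _; first by move=> _; rewrite addn0.
have m_lt : m < 2 ^ m by apply: ltn_expl.
move: IHm; rewrite !(expnS 2 m.+2) => IHm mn wj.
have m2 : 4 <= 2 ^ m.+2 by rewrite !expnS; lia.
have m2' : m.+2 + 2 <= 2 ^ m.+2 by rewrite !expnS; lia.
have -> : j + (2 * 2 ^ m.+2 - m.+3 - 2) =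
          (j + (2 ^ m.+2 - 2).+1) + (2 ^ m.+2 - m.+2 - 2) by lia.
apply: IHm; [by []|by lia|]; apply: size_win_block; [by []|by lia|by []|].
apply: size_win_leq wj => //.
have -> : 2 ^ m.+2 - 2 + (2 ^ m.+2 - 2) = (2 * 2 ^ m.+2 - 5).+1 by lia.
have -> : 2 * 2 ^ m.+2 - 3 = (2 * 2 ^ m.+2 - 5).+2 by lia.
by rewrite !triS; lia.
Qed.

(** Here [p] counts the diagonals between the last complete doubling and the main antidiagonal; the
    [maxn] term is the surplus beyond [tri n] that they bring. *)
Lemma size_win_half l j : 1 < l -> 1 < n -> 2 ^ l - 3 <= n < 2 ^ l.+1 - 3 ->
  let p := n + 3 - 2 ^ l in
  size_win j (tri n + maxn (p.-1).*2 (0 < p)) ->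
  size_win (j + (n - l + 2)) 0.
Proof.
move=> l_gt1 n_gt1 ln; move pE: (n + 3 - 2 ^ l) => p /= wj.
have l_le : l.+2 <= 2 ^ l by apply: expn2_ge.
have l_le_n : l <= n by case: (l =P 2) => [->//|l2]; have := expn2_gt l_gt1 l2; lia.
rewrite expnS in ln.
have -> : j + (n - l + 2) = (j + p + (2 ^ l - l - 2)).+1 by lia.
apply: size_win_start; first by lia.
apply: size_win_reach; [by []|by lia|].
case: p pE wj => [|[|p]] pE wj.
- by rewrite (_ : 2 ^ l - 3 = n); [apply: size_win_leq wj; lia|lia].
- rewrite (_ : 2 ^ l - 3 = n.-1); last by lia.
  have [s en] : exists s, n = s.+2 by exists (n - 2); lia.
  rewrite addn1; apply: (@size_win_grow1 _ s); [by lia|by rewrite en triS; lia|].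
  by apply: size_win_leq wj => //; rewrite en succnK !triS; lia.
have -> : j + p.+2 = j.+1 + p.+1 by lia.
apply: size_win_block; [by lia|by lia|by lia|].
rewrite (_ : 2 ^ l - 2 + p = n.-1); last by lia.
apply: size_win_grow2; first by lia.
by apply: size_win_leq wj; lia.
Qed.

Lemma size_win_cooling l : 1 < l -> 2 < n -> n != 5 -> 2 ^ l - 3 <= n < 2 ^ l.+1 - 3 ->
  size_win (2 * n - 2 * l + 2) 0.
Proof.
move=> l_gt1 n_gt2 n5 ln.
have n_gt1 : 1 < n by lia.
have l_le : l.+2 <= 2 ^ l by apply: expn2_ge.
have l_le_n : l <= n by case: (l =P 2) => [->//|l2]; have := expn2_gt l_gt1 l2; lia.
have -> : 2 * n - 2 * l + 2 = (n - l) + (n - l + 2) by move: ln; rewrite expnS; lia.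
apply: size_win_half => //; set p := n + 3 - 2 ^ l.
have nn := tri_grid.
have trin : tri n = tri n.-1 + n by case: (n) n_gt1 => [|m _]; rewrite ?triS //; lia.
(* What is left of [n * n] after [tri n] and the surplus. *)
pose e := tri n.-1 - maxn (p.-1).*2 (0 < p).
have eE : e = tri n.-1 - maxn (p.-1).*2 (0 < p) by [].
suff : size_win (n - l) (n * n - e) by apply: size_win_leq => //; lia.
have [i el] : exists i, l = i.+2 by exists (l - 2); lia.
have i_pos : 0 < 2 ^ i by rewrite expn_gt0.
have l4 : i = 0 \/ i = 1 \/ 4 <= 2 ^ i.
  case: (i) => [|[|i']]; [by left|by right; left|right; right].
  by rewrite !expnS; have := expn_gt0 2 i'; lia.
have tri_big : (p.-1).*2 <= tri n.-1.
  have [m en] : exists m, n = m.+3 by exists (n - 3); lia.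
  have := tri_double m.+2; have p_le : p.-1 <= m.+1 by lia.
  by rewrite en succnK; nia.
move: ln; rewrite el !expnS => ln.
have pE : p = n + 3 - 4 * 2 ^ i by rewrite /p el !expnS; lia.
clearbody e p; move: l_le l_le_n l_gt1 nn; subst l => _ _ _ _.
(* The range of [r] in [size_win_finish] is met by [r = n] with [i], then by [r = n - 1] with [i] if
   [n = 6 * 2 ^ i - 1], and by [r = n] with [i + 1] for larger [n]. *)
have [small|large] := leqP n (6 * 2 ^ i - 2).
  rewrite (_ : n - i.+2 = n - i - 2); last by clear; lia.
  apply: size_win_finish => //.
    by case: l4 => [i0|[i1|]]; rewrite ?i0 ?i1 in ln n5 small *; lia.
  by case: l4 => [i0|[i1|]]; rewrite ?i0 ?i1 in ln n5 small pE *; lia.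
have [n1|n2] : n = 6 * 2 ^ i - 1 \/ 6 * 2 ^ i <= n by lia.
  apply: (@size_win_leq (n.-1 - i - 2) _ _ (n * n - e)) => //; first by clear; lia.
  by apply: size_win_finish => //; lia.
apply: (@size_win_leq (n - i.+1 - 2) _ _ (n * n - e)) => //; first by clear; lia.
by apply: size_win_finish => //; rewrite expnS; lia.
Qed.

(** Decides the hypothesis of [size_win_step] for a concrete [n]; the first conjunct handles all
    [d >= n] at once. *)
Definition cool_check a b : bool :=
  (minn (n * n) b <= (a + n).+1) &&
  all (fun x => all (fun d => (x <= tri d.-1) || (n * n <= x + tri d) ==>
                              (minn (n * n) b <= (x + d).+1)) (iota 0 n))
      (iota a (n * n)).

Lemma size_win_check j a b : 0 < a -> cool_check a b ->
  size_win j b -> size_win j.+1 a.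
Proof.
move=> a_gt0 /andP[ab /allP chk]; apply: size_win_step => // x d ax nd.
have [ge_d|lt_d] := leqP n d; first by lia.
have [x_big|x_small] := leqP (n * n) x; first by lia.
have /chk/allP/(_ d) : x \in iota a (n * n) by rewrite mem_iota; lia.
rewrite mem_iota add0n lt_d => /(_ isT)/implyP; apply.
by case: nd; lia.
Qed.

Fixpoint cool_path a s : bool :=
  if s is b :: s' then (0 < a) && cool_check a b && cool_path b s' else n * n <= a.

Lemma size_win_path s : 0 < n -> cool_path 1 s -> size_win (size s).+1 0.
Proof.
move=> n_gt0 chk; apply: size_win_start => //.
elim: s 1 chk => /= [a|b s IHs a /andP[/andP[a_gt0 ab] /IHs]]; first exact: size_win0.
exact: size_win_check.
Qed.

End Cooling.

(** [size_win_cooling] does not apply to [n = 2] and [n = 5], and is too weak for [7 * n / 4] at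
    [n = 4] and [n = 12]. The lists give numbers of vertices surely burned after the second and
    later rounds. *)
Lemma small_cooling k : 0 < k ->
  [/\ size_win 2 k 2 0, size_win 4 k 5 0, size_win 5 k 7 0 & size_win 12 k 19 0].
Proof.
move=> k_gt0; split.
- apply: (@size_win_path _ _ k_gt0 [:: 4]); [by []|by vm_compute].
- apply: (@size_win_path _ _ k_gt0 [:: 4; 9; 14; 16]); [by []|by vm_compute].
- apply: (@size_win_path _ _ k_gt0 [:: 4; 9; 15; 20; 24; 25]); [by []|by vm_compute].
apply: (@size_win_leq 12 k k_gt0 18 19 0 0); [by []|by []|].
apply: (@size_win_path _ _ k_gt0
  [:: 4; 9; 15; 22; 31; 41; 52; 64; 77; 90; 101; 111; 120; 128; 135; 140; 144]).
  by [].
by vm_compute.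
Qed.

(** * Fires near the corners of the grid *)

Section CornerStrategy.
Local Open Scope nat_scope.
Variable n : nat.
Implicit Types u v w z : grid n.

(** Distance to the nearer end of a side, so that [cdist] is the distance to the nearest corner. *)
Definition fold_coord a : nat := minn a (n.-1 - a).
Definition cdist z : nat := fold_coord (row_of z) + fold_coord (col_of z).
Definition quadrant z : bool * bool := ((row_of z).*2 < n, (col_of z).*2 < n).

Lemma fold_coord_inj a b : a < n -> b < n -> (a.*2 < n) = (b.*2 < n) ->
  fold_coord a = fold_coord b -> a = b.
Proof. by rewrite /fold_coord; lia. Qed.

Lemma card_below_antidiagonal r :
  #|[set p : 'I_r * 'I_r | p.1 + p.2 < r]| <= tri r.
Proof.
rewrite -sum1_card (eq_bigl (fun p : 'I_r * 'I_r => xpredT p.1 && (p.1 + p.2 < r))); last first.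
  by move=> p; rewrite inE.
rewrite -(pair_big_dep xpredT (fun i j : 'I_r => i + j < r) (fun _ _ => 1)) /=.
apply: leq_trans (sum_subn_tri r r); apply: leq_sum => i _.
have -> : r - i = \sum_(j < r - i) 1 by rewrite sum_nat_const card_ord muln1.
rewrite (big_ord_widen r (fun=> 1)) ?leq_subr //.
by rewrite leq_eqVlt; apply/orP; left; apply/eqP/eq_bigl => j; lia.
Qed.

Lemma card_corner_triangle s r : #|[set z | (quadrant z == s) && (cdist z < r)]| <= tri r.
Proof.
case: r => [|r].
  by rewrite (_ : [set z | _] = set0) ?cards0 //; apply/setP => z; rewrite !inE andbF.
apply: leq_trans (card_below_antidiagonal r.+1).
pose f z : 'I_r.+1 * 'I_r.+1 := (inord (fold_coord (row_of z)), inord (fold_coord (col_of z))).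
rewrite -(@card_in_imset _ _ f) => [|z z']; last first.
  rewrite !inE /cdist => /andP[/eqP <- zr] /andP[/eqP[ra ca] zr'] [].
  move/(congr1 val) => /=; rewrite !inordK; [move=> fr|lia|lia].
  move/(congr1 val) => /=; rewrite !inordK; [move=> fc|lia|lia].
  by apply: coord_inj; apply: fold_coord_inj; rewrite ?row_of_lt ?col_of_lt.
apply: subset_leq_card; apply/subsetP => p /imsetP[z]; rewrite inE /cdist.
by move=> /andP[_ zr] ->; rewrite inE /= !inordK; lia.
Qed.

Definition opposite_corner u w : Prop :=
  row_of w = (if (row_of u).*2 < n then n.-1 else 0) /\
  col_of w = (if (col_of u).*2 < n then n.-1 else 0).

Lemma opposite_corner_ex u : exists w, opposite_corner u w.
Proof.
have n_gt0 : 0 < n by have := row_of_lt u; lia.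
by apply: grid_point; case: ifP; lia.
Qed.

Lemma adist_fold a b : a < n -> b < n -> adist a b + fold_coord a < n.
Proof. by rewrite /adist /fold_coord; lia. Qed.

Lemma adist_opposite a b c : a < n -> b < n ->
  c = (if a.*2 < n then n.-1 else 0) ->
  adist a b + adist b c + fold_coord a < n \/ adist a b <= fold_coord a.
Proof.
rewrite /adist /fold_coord => an bn ->; have [ab|ba] := leqP a b; case: ifP; lia.
Qed.

Lemma adist_two_sides a b c : a < n -> b < n -> c < n -> (a.*2 < n) != (c.*2 < n) ->
  [\/ adist a b + adist c b < n, adist a b <= fold_coord a | adist c b <= fold_coord c].
Proof.
rewrite /adist /fold_coord => an bn cn ac.
have [ab|ba] := leqP a b; have [cb|bc] := leqP c b.
- have [ac'|ca] := leqP a c; [apply: Or33 | apply: Or32]; lia.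
- by apply: Or31; lia.
- by apply: Or31; lia.
by have [ac'|ca] := leqP a c; [apply: Or32 | apply: Or33]; lia.
Qed.

Lemma adist_corner a c : 5 < n -> a < n -> c = 0 \/ c = n.-1 -> adist a c <= 2 ->
  (a.*2 < n) = (c.*2 < n) /\ fold_coord a <= adist a c.
Proof. by rewrite /adist /fold_coord => n5 an [] -> ?; split; lia. Qed.

Lemma gdist_le_cdist u z : gdist u z + cdist u <= 2 * n - 2.
Proof.
have := adist_fold (row_of_lt u) (row_of_lt z).
by have := adist_fold (col_of_lt u) (col_of_lt z); rewrite /gdist /cdist; lia.
Qed.

(** Either [z] lies between [u] and [w] in both coordinates, and the distance to [w] is saved, or in
    one coordinate [z] is no farther from [u] than the side near [u]. *)
Lemma gdist_corner h u w z : 2 * h + 2 <= n -> h - 2 <= cdist u < h ->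
  opposite_corner u w -> 3 <= gdist z w -> gdist u z <= 2 * n - 3 - h.
Proof.
move=> hn uh [wr wc].
have := adist_fold (row_of_lt u) (row_of_lt z).
have := adist_fold (col_of_lt u) (col_of_lt z).
have := adist_opposite (row_of_lt u) (row_of_lt z) wr.
have := adist_opposite (col_of_lt u) (col_of_lt z) wc.
by move: uh; rewrite /gdist /cdist => ? [] ? [] ?; lia.
Qed.

(** In a coordinate where the quadrants differ, [z] lies between [u] and [v], so one of them is
    within half a side, or behind one of them, so close to it. *)
Lemma gdist_two_corners h u v z : 2 * h + 2 <= n -> 2 < h ->
  cdist u < h - 2 -> cdist v < h - 2 -> quadrant u != quadrant v ->
  gdist u z <= 2 * n - 2 - h \/ gdist v z <= 2 * n - 2 - h.
Proof.
rewrite /quadrant xpair_eqE negb_and => hn h_gt2 uh vh uv.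
have := adist_fold (row_of_lt u) (row_of_lt z).
have := adist_fold (col_of_lt u) (col_of_lt z).
have := adist_fold (row_of_lt v) (row_of_lt z).
have := adist_fold (col_of_lt v) (col_of_lt z).
move: uh vh; rewrite /gdist /cdist.
case/orP: uv => [ruv|cuv].
  by case: (adist_two_sides (row_of_lt u) (row_of_lt z) (row_of_lt v) ruv); lia.
by case: (adist_two_sides (col_of_lt u) (col_of_lt z) (col_of_lt v) cuv); lia.
Qed.

Lemma near_corner u w z : 5 < n -> opposite_corner u w -> gdist z w < 3 ->
  quadrant z == quadrant w /\ cdist z <= gdist z w.
Proof.
move=> n_gt5 [wr wc] zw.
have rw : row_of w = 0 \/ row_of w = n.-1 by rewrite wr; case: ifP; auto.
have cw : col_of w = 0 \/ col_of w = n.-1 by rewrite wc; case: ifP; auto.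
move: zw; rewrite /gdist /cdist /quadrant => zw.
have [|<- r_le] := adist_corner n_gt5 (row_of_lt z) rw; first by lia.
have [|<- c_le] := adist_corner n_gt5 (col_of_lt z) cw; first by lia.
by rewrite eqxx; split=> //; apply: leq_add.
Qed.

Lemma near_corner_neighbor u w z : 5 < n -> opposite_corner u w -> 1 < gdist w z ->
  exists2 z', 3 <= gdist z' w & gdist z' z <= 1.
Proof.
move=> n_gt5 [wr wc] zw; have zr := row_of_lt z.
have [lt3|ge3] := ltnP (gdist z w) 3; last by exists z; rewrite // /gdist /adist; lia.
have rw : row_of w = 0 \/ row_of w = n.-1 by rewrite wr; case: ifP; auto.
move: (zw) (lt3); rewrite /gdist; case: rw => [w0|w1] zw' lt3'.
  have [||z' [z'r z'c]] := @grid_point n (row_of z).+1 (col_of z); last first.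
  - by exists z'; rewrite z'r z'c; move: zw' lt3'; rewrite w0 /adist; lia.
  - exact: col_of_lt.
  by move: lt3'; rewrite w0 /adist; lia.
have [||z' [z'r z'c]] := @grid_point n (row_of z).-1 (col_of z); last first.
- by exists z'; rewrite z'r z'c; move: zw' lt3'; rewrite w1 /adist; lia.
- exact: col_of_lt.
by lia.
Qed.

Lemma reveal_all k (G : sgraph) (B Rv S : {set G}) : S \in reveal_moves k B Rv ->
  #|~: B| <= k -> B :|: (Rv :|: S) = setT.
Proof.
rewrite inE => /andP[SU /eqP cS] Bk.
have Uk : #|~: (B :|: Rv)| <= k.
  by apply: leq_trans Bk; rewrite subset_leq_card // setCS subsetUl.
have -> : S = ~: (B :|: Rv).
  by apply/eqP; rewrite eqEcard SU cS (minn_idPr Uk) leqnn.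
by rewrite setUA setUCr.
Qed.

Lemma mem_iter_ball j (B : {set grid n}) u z : u \in B -> gdist u z <= j ->
  z \in iter j (@propagate (grid n)) B.
Proof. by move=> uB /mem_ball; apply: iter_propagate_mem. Qed.

Variable k : nat.

(* When only the triangle of the six vertices nearest to the far corner [w] is
   left, it is revealed entirely; burning [w] then saves two rounds. *)
Lemma win_endgame i u w (B Rv : {set grid n}) : 5 < k -> 5 < n -> u \in B ->
  opposite_corner u w -> (forall z, 3 <= gdist z w -> gdist u z <= i.+1) ->
  win k i.+2 B Rv.
Proof.
move=> k_gt5 n_gt5 uB uw far.
rewrite -addn2; apply: (@win_wait _ _ _ _ _ _ 0) => [|B' Rv' sB' _]; first by left.
have farB z : 3 <= gdist z w -> z \in propagate B'.
  move=> /far uz; apply: (subsetP (propagate_mono sB')).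
  exact: (mem_iter_ball uB uz).
right=> S Sin; have allB : #|~: propagate B'| <= k.
  apply: leq_trans k_gt5; apply: leq_trans (card_corner_triangle (quadrant w) 3).
  apply: subset_leq_card; apply/subsetP => z; rewrite !in_setC in_set.
  apply: contraR => zw; apply: farB; rewrite leqNgt; apply: contra zw => zw.
  by have [-> le_zw] := near_corner n_gt5 uw zw; rewrite (leq_ltn_trans le_zw).
have [|B2 B2in wB2] := @burn_moves_mem _ (propagate B') (Rv' :|: S) w.
  by rewrite (reveal_all Sin).
exists B2 => //; apply: win_passive; apply/setP => z; rewrite [RHS]inE.
have [near_w|far_w] := leqP (gdist w z) 1; first exact: mem_iter_ball near_w.
have [z' z'w z'z] := near_corner_neighbor n_gt5 uw far_w.
apply: mem_iter_ball z'z; apply: (subsetP (burn_moves_sub B2in)); exact: farB.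
Qed.

Variable h : nat.
Hypotheses (hn : 2 * h + 2 <= n) (h_gt3 : 3 < h) (hk : h <= k) (k_gt5 : 5 < k).

Lemma win_far_from_corners u (B Rv : {set grid n}) : u \in B -> h - 2 <= cdist u ->
  win k (2 * n - 2 - h) B Rv.
Proof.
move=> uB hu; have [uh|hu'] := ltnP (cdist u) h; last first.
  apply: win_passive; apply/setP => z; rewrite [RHS]inE.
  by apply: (mem_iter_ball uB); have := gdist_le_cdist u z; lia.
have [w uw] := opposite_corner_ex u.
have -> : 2 * n - 2 - h = (2 * n - 4 - h).+2 by lia.
apply: (@win_endgame _ u w) => // [|z zw]; first by lia.
by have := gdist_corner hn _ uw zw; rewrite hu uh; lia.
Qed.

Lemma win_corner_strategy : win k (2 * n - 2 - uphalf h) set0 (set0 : {set grid n}).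
Proof.
(* One round to burn [v1], [h./2 - 2] rounds of waiting, one round to burn [x], and the rest for
   spreading. *)
have -> : 2 * n - 2 - uphalf h = ((h./2 - 2) + (2 * n - 2 - h).+1).+1 by lia.
apply: (@win_step _ _ _ _ _ 0); first by left.
move=> Rv1 kn1; have [v1 v1in] : exists x, x \in propagate set0 :|: Rv1.
  apply/set0Pn; case: kn1 => [kR|->].
    by rewrite -card_gt0; apply: leq_trans (subset_leq_card (subsetUr _ _)); lia.
  by rewrite -card_gt0 cardsT card_grid muln_gt0; lia.
exists v1 => // B1 v1B1 _ {}kn1.
apply: (win_wait kn1) => B2 Rv2 sB2 kn2.
have v1B2 : v1 \in B2.
  by apply: (subsetP sB2); apply: (subsetP (iter_propagate_leq B1 (leq0n _))).
apply: (win_step kn2) => Rv3 kn3.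
(* By now [h./2 * k > tri (h - 2)] vertices are revealed, or all are known; they do not fit into the
   triangle at the corner nearest to [v1]. *)
have [x xin xout] : exists2 x, x \in propagate B2 :|: Rv3 &
    ~~ ((quadrant x == quadrant v1) && (cdist x < h - 2)).
  pose tr := [set z | (quadrant z == quadrant v1) && (cdist z < h - 2)].
  have /subsetPn[x xin] : ~~ (propagate B2 :|: Rv3 \subset tr); last first.
    by rewrite inE; exists x.
  apply/negP => /subset_leq_card; apply/negP; rewrite -ltnNge.
  apply: leq_ltn_trans (card_corner_triangle _ _) _.
  have tri_h := tri_double (h - 2).
  have [q hq] : exists q, h - 2 = q by eexists.
  case: kn3 => [kR|->]; last by rewrite cardsT card_grid; nia.
  apply: leq_trans (subset_leq_card (subsetUr _ _)); apply: leq_trans kR.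
  have -> : 0 + k + (h./2 - 2) * k + k = h./2 * k.
    by rewrite add0n -mulSn addnC -mulSn; congr (_ * _); lia.
  have : h./2 * h <= h./2 * k by rewrite leq_mul2l hk orbT.
  have : (h - 2) * (h - 2).+1 < 2 * (h./2 * h).
    have : h <= 2 * h./2 + 1 by lia.
    by nia.
  by lia.
exists x => // B3 xB3 sB3 _.
have v1B3 : v1 \in B3 by apply: (subsetP sB3); apply: (subsetP (propagateS _)).
have [hx|hx] := leqP (h - 2) (cdist x); first exact: win_far_from_corners hx.
have [hv|hv] := leqP (h - 2) (cdist v1); first exact: win_far_from_corners hv.
move: xout; rewrite hx andbT => xv; apply: win_passive; apply/setP => z.
rewrite [RHS]inE; have [] := gdist_two_corners z hn _ hx hv xv; first by lia.
  exact: mem_iter_ball.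
exact: mem_iter_ball.
Qed.

End CornerStrategy.

(** * Spreading fires over the tiles of a partition *)

Section Tiling.
Local Open Scope nat_scope.
Variables (k : nat) (G : sgraph) (T : finType) (tl : G -> T) (m : nat).
Hypotheses (k_gt0 : 0 < k) (km : k <= m).
Hypothesis G_gt0 : 0 < #|G|.
Hypothesis card_tile : forall a, #|[set z | tl z == a]| <= m.

Lemma card_tile_preim (A : {set T}) : #|[set z | tl z \in A]| <= m * #|A|.
Proof.
rewrite -sum1_card (partition_big tl (mem A)) /= => [|z]; last by rewrite inE.
rewrite mulnC -sum_nat_const; apply: leq_sum => a aA.
apply: leq_trans (card_tile a); rewrite -sum1_card leq_eqVlt; apply/orP; left.
apply/eqP/eq_bigl => z; rewrite !inE; case: eqP => [->|]; rewrite ?andbF //.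
by rewrite aA.
Qed.

Definition tiles_reached t (B : {set G}) : Prop :=
  t * k <= m * #|tl @: B| \/ tl @: B = tl @: [set: G].

(* A tile has at most [m >= k] vertices, so either a tile without fire contains
   a revealed vertex, or the tiles with a fire contain all revealed vertices. *)
Lemma win_tiles_step t i j (B Rv : {set G}) : known B Rv (t * k) -> tiles_reached t B ->
  (forall B' Rv', known B' Rv' ((t + i) * k) -> tiles_reached (t + i) B' -> win k j B' Rv') ->
  win k (i + j) B Rv.
Proof.
elim: i t B Rv => [|i IHi] t B Rv knB reach wB; first by apply: wB; rewrite addn0.
rewrite addSn; apply: (win_step knB) => Rv'; rewrite addnC -mulSn => kn'.
have IH (B2 : {set G}) x : x \in B2 -> propagate B \subset B2 -> known B2 Rv' (t.+1 * k) ->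
    tiles_reached t.+1 B2 -> win k (i + j) B2 Rv'.
  move=> _ _ kn2 reach2; apply: (IHi t.+1) => // B' Rv'' kn'' reach''.
  by apply: wB; rewrite addnS -addSn.
have reachS (B2 : {set G}) : propagate B \subset B2 -> tl @: B \subset tl @: B2.
  by move=> sB2; apply/imsetS/(subset_trans (propagateS B)).
have [/subsetP all_in|/subsetPn[x xin xout]] :=
  boolP (propagate B :|: Rv' \subset [set z | tl z \in tl @: propagate B]); last first.
  exists x => // B2 xB2 sB2 kn2; apply: (IH _ x) => //.
  have [reach_t|reach_all] := reach; last first.
    right; apply/eqP; rewrite eqEsubset imsetS ?subsetT //= -reach_all.
    exact: reachS.
  left; rewrite mulSn; apply: leq_trans (leq_add km reach_t) _.
  rewrite -mulnS leq_mul2l; apply/orP; right.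
  apply: proper_card; apply/properP; split; first exact: reachS.
  exists (tl x); first exact: imset_f.
  rewrite inE in xout; apply: contra xout; apply/subsetP/imsetS/propagateS.
have [x xin] : exists x, x \in propagate B :|: Rv'.
  apply/set0Pn; rewrite -card_gt0; case: kn' => [kR|->]; last by rewrite cardsT.
  apply: leq_trans (subset_leq_card (subsetUr _ _)); apply: leq_trans kR.
  by rewrite mulSn addn_gt0 k_gt0.
exists x => // B2 xB2 sB2 kn2; apply: (IH _ x) => //.
case: kn' => [kR|all_known]; last first.
  right; apply/eqP; rewrite eqEsubset imsetS ?subsetT //=.
  apply/subsetP => _ /imsetP[z _ ->].
  have : z \in propagate B :|: Rv' by rewrite all_known inE.
  move/all_in; rewrite inE; exact/subsetP/imsetS.
left; apply: leq_trans kR _.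
apply: leq_trans (_ : m * #|tl @: propagate B| <= _); last first.
  by rewrite leq_mul2l subset_leq_card ?orbT ?imsetS.
apply: leq_trans (card_tile_preim _); apply: subset_leq_card.
by apply/subsetP => z zR; apply: all_in; rewrite inE zR orbT.
Qed.

Variables (D r : nat) (c : T -> G).
Hypothesis tile_diam : forall u z, tl u = tl z -> z \in iter D (@propagate G) [set u].
Hypothesis tile_radius : forall z, z \in iter r (@propagate G) [set c (tl z)].

(** After [t] rounds at most [e] nonempty tiles lack a fire, and the next reveal shows everything.
    The other tiles burn within [D] rounds, while these need [e] rounds to ignite and [r] to
    spread. *)
Lemma win_tiling t e j : #|G| <= t.+1 * k -> #|T| * m < t * k + e.+1 * m ->
  D <= j -> e + r <= j -> win k (t + j) set0 (set0 : {set G}).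
Proof.
move=> Gt Tt Dj erj; apply: (@win_tiles_step 0); [by left|by left|].
rewrite add0n => B Rv knB reach.
pose U := ~: (tl @: B).
(* [win_burn_sequence] counts down, so the tile of index [s] is served by [f (j.-1 - s)], which
   keeps at least [j - e >= r] rounds. The last branch is only a default. *)
pose f i := if onth (enum U) (j.-1 - i) is Some a then c a
            else c (tl (enum_val (Ordinal G_gt0))).
have m_gt0 : 0 < m by apply: leq_trans km.
apply: (@win_burn_sequence _ _ _ _ _ _ f knB); first by rewrite addnC -mulSn.
move=> z; have [|zU] := boolP (tl z \in tl @: B).
  case/imsetP => u uB /esym/tile_diam zu; left.
  by apply: (subsetP (iter_propagate_leq B Dj)); apply: iter_propagate_mem zu.
have zU' : tl z \in enum U by rewrite mem_enum inE.
have idx : index (tl z) (enum U) < e.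
  have Ue : #|U| <= e; last by apply: leq_trans Ue; rewrite cardE index_mem.
  case: reach => [reach|reach]; last by rewrite reach imset_f in zU.
  have := cardsC (tl @: B); rewrite -/U => cT.
  rewrite -ltnS -(ltn_pmul2l m_gt0); rewrite -cT mulnDl in Tt.
  by rewrite -(ltn_add2l (t * k)) mulnC [m * e.+1]mulnC; lia.
right; exists (j.-1 - index (tl z) (enum U)); first by lia.
rewrite /f subKn; last by lia.
rewrite onthE (nth_map (tl z)) ?index_mem // nth_index //.
apply: (subsetP (iter_propagate_leq _ _)) (tile_radius z); lia.
Qed.

End Tiling.

(** * Square tiles in the grid *)

Section GridTiling.
Local Open Scope nat_scope.
Variables n k w q : nat.
Hypotheses (n_gt0 : 0 < n) (k_gt0 : 0 < k) (kw : k <= w * w) (nqw : n <= q * w).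

Let w_gt0 : 0 < w. Proof. by case: (w) kw => //; rewrite leqNgt k_gt0. Qed.

Lemma tile_coord_lt a : a < n -> a %/ w < q.
Proof. by move=> an; rewrite ltn_divLR // (leq_trans an). Qed.

Definition grid_tile (z : grid n) : 'I_q * 'I_q :=
  (Ordinal (tile_coord_lt (row_of_lt z)), Ordinal (tile_coord_lt (col_of_lt z))).

Lemma grid_tileP (u z : grid n) : grid_tile u = grid_tile z ->
  row_of u %/ w = row_of z %/ w /\ col_of u %/ w = col_of z %/ w.
Proof. by case. Qed.

Lemma card_grid_tile a : #|[set z | grid_tile z == a]| <= w * w.
Proof.
pose f (z : grid n) : 'I_w * 'I_w :=
  (Ordinal (ltn_pmod (row_of z) w_gt0), Ordinal (ltn_pmod (col_of z) w_gt0)).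
rewrite -(@card_in_imset _ _ f) => [|u z].
  by apply: leq_trans (max_card _) _; rewrite card_prod !card_ord.
rewrite !inE => /eqP <- /eqP/grid_tileP[rd cd] [rm cm].
by apply: coord_inj; rewrite [LHS](divn_eq _ w) [RHS](divn_eq _ w); congruence.
Qed.

Lemma win_grid_tiling t e j : n * n <= t.+1 * k -> q * q * (w * w) < t * k + e.+1 * (w * w) ->
  2 * w.-1 <= j -> e + 2 * w./2 <= j -> win k (t + j) set0 (set0 : {set grid n}).
Proof.
move=> nt qt wj ej.
(* Centers of tiles cut by the border are moved back into the grid. *)
pose mid a := minn n.-1 (a * w + w./2).
have mid_lt a : mid a < n by rewrite /mid; lia.
pose c (a : 'I_q * 'I_q) : grid n := (Ordinal (mid_lt a.1), Ordinal (mid_lt a.2)).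
have G_gt0 : 0 < #|grid n| by rewrite card_grid muln_gt0 n_gt0.
apply: (@win_tiling k _ _ grid_tile (w * w) k_gt0 kw G_gt0 card_grid_tile
  (2 * w.-1) (2 * w./2) c _ _ _ e) => //; rewrite ?card_grid ?card_prod ?card_ord //.
- move=> u z /grid_tileP[rd cd]; apply: mem_ball; rewrite /gdist /adist.
  have := divn_eq (row_of u) w; have := divn_eq (row_of z) w.
  have := divn_eq (col_of u) w; have := divn_eq (col_of z) w.
  have := ltn_pmod (row_of u) w_gt0; have := ltn_pmod (row_of z) w_gt0.
  have := ltn_pmod (col_of u) w_gt0; have := ltn_pmod (col_of z) w_gt0.
  by rewrite rd cd; lia.
move=> z; apply: mem_ball; rewrite /gdist /adist /row_of /col_of /= -/(row_of z) -/(col_of z).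
have near a : a < n -> mid (a %/ w) - a + (a - mid (a %/ w)) <= w./2.
  have := ltn_pmod a w_gt0; have := divn_eq a w; rewrite /mid; lia.
by rewrite mul2n -addnn leq_add // near ?row_of_lt ?col_of_lt.
Qed.

Lemma win_all_revealed t j (f : nat -> grid n) : n * n <= t.+1 * k ->
  (forall z, exists2 i, i < j & gdist (f i) z <= i) ->
  win k (t + j) set0 (set0 : {set grid n}).
Proof.
move=> nt cov; apply: (@win_wait _ _ _ _ _ _ 0) => [|B' Rv' _]; first by left.
rewrite add0n => kn'; apply: (win_burn_sequence (f := f) kn').
  by rewrite card_grid addnC -mulSn.
by move=> z; right; have [i ij /mem_ball] := cov z; exists i.
Qed.

End GridTiling.

(** * Covering the grid by diamonds *)

Section DiamondCovering.
Local Open Scope nat_scope.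

Lemma sum_find (h : nat -> nat) l a : a < \sum_(i < l) h i ->
  exists i, [/\ i < l, \sum_(j < i) h j <= a & a < \sum_(j < i) h j + h i].
Proof.
elim: l => [|l IHl]; first by rewrite big_ord0.
rewrite big_ord_recr /= => lt_a; have [/IHl[i [il lo hi]]|ge_a] := ltnP a (\sum_(j < l) h j).
  by exists i; split=> //; apply: leq_trans il _.
by exists l; split.
Qed.

Variables n y : nat.
(* The [y] balls with radii in [i * y, i.+1 * y) are used as diamonds of radius
   [i * y].  A strip of height [strip i] is covered by placing them in rows of
   [diamonds_per_row i] centers at vertical distance [i * y] and horizontal
   distance [2 * (i * y)], every other row being shifted by [i * y]. *)
Definition diamonds_per_row i := n %/ (2 * (i * y)) + 2.
Definition strip i := i * y * (y %/ diamonds_per_row i).-1.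

(** An area count: [y] diamonds of area [2 * r ^ 2], where [r = i * y], against a strip of width
    [n], with margins for rounding. *)
Lemma strip_ge i : 2 * (i * y) ^ 2 * y <= (strip i + 2 * (i * y)) * (n + 4 * (i * y)).
Proof.
rewrite /strip; set r := i * y; set d := diamonds_per_row i.
have dr : d * (2 * r) <= n + 4 * r.
  by rewrite /d /diamonds_per_row -/r mulnDl; have := leq_trunc_div n (2 * r); lia.
have d_gt0 : 0 < d by rewrite /d /diamonds_per_row addn2.
have := ltn_ceil y d_gt0; move: (y %/ d) => p yd.
have sp : r * p.+1 <= r * p.-1 + 2 * r by case: p {yd} => [|p]; rewrite ?mulnS; lia.
apply: leq_trans (leq_mul (leqnn _) dr); apply: leq_trans (_ : r * p.+1 * (d * (2 * r)) <= _).
  by rewrite [leqRHS](_ : _ = 2 * r ^ 2 * (p.+1 * d)) ?leq_mul2l ?(ltnW yd) ?orbT //; ring.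
by rewrite leq_mul2r sp orbT.
Qed.

Hypothesis n_gt0 : 0 < n.

Definition clamp_point a b : grid n :=
  (Ordinal (ltac:(lia) : minn n.-1 a < n), Ordinal (ltac:(lia) : minn n.-1 b < n)).

Lemma gdist_clamp_point a b z :
  gdist (clamp_point a b) z <= adist a (row_of z) + adist b (col_of z).
Proof.
have [rz cz] := (row_of_lt z, col_of_lt z).
rewrite /gdist /row_of /col_of /= -/(row_of z) -/(col_of z).
by apply: leq_add; rewrite /adist; lia.
Qed.

(** The digits of [v] are the strip [i = v %/ y], the row inside it and the place in the row. As
    [i * y <= v], the ball of radius [v] contains the diamond. *)
Definition diamond_center v : grid n :=
  let i := v %/ y in let j := v %% y %/ diamonds_per_row i in
  clamp_point (\sum_(l < i) strip l + i * y * j)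
              (2 * (i * y) * (v %% y %% diamonds_per_row i) + i * y * odd j).

Lemma adistDl a b c : adist (a + b) (a + c) = adist b c.
Proof. by rewrite /adist !subnDl. Qed.

(** Staggered diamonds tile the plane: a point between rows [j] and [j.+1] with horizontal offset
    [al] is covered from one of these rows, by the center of its own period or the next. *)
Lemma diamond_neighbors r al be j : 0 < r -> al < 2 * r -> be < r ->
  exists j' s, [/\ j' <= j.+1, s <= 1 &
    adist (r * j') (r * j + be) + adist (2 * r * s + r * odd j') al <= r].
Proof.
move=> r_gt0 al_r be_r; rewrite /adist; case oj: (odd j).
  have [ok|no] := leqP (be + ((al - r) + (r - al))) r.
    by exists j, 0; rewrite oj; split=> //; lia.
  have [al_le|al_gt] := leqP al r.
    by exists j.+1, 0; rewrite /= oj mulnS; split=> //; lia.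
  by exists j.+1, 1; rewrite /= oj mulnS; split=> //; lia.
have [ok|no] := leqP (r - be + ((al - r) + (r - al))) r.
  by exists j.+1, 0; rewrite /= oj mulnS; split=> //; lia.
have [al_le|al_gt] := leqP al r.
  by exists j, 0; rewrite oj; split=> //; lia.
by exists j, 1; rewrite oj; split=> //; lia.
Qed.

Lemma diamond_cover l z : n <= \sum_(i < l) strip i ->
  exists2 v, v < l * y & gdist (diamond_center v) z <= v.
Proof.
move=> nl; have [|i [il lo hi]] := @sum_find strip l (row_of z).
  exact: leq_trans (row_of_lt z) nl.
set o := \sum_(j < i) strip j in lo hi; set r := i * y.
have strip_gt0 : 0 < strip i by lia.
have r_gt0 : 0 < r by move: strip_gt0; rewrite /strip -/r; case: (r).
have y_gt0 : 0 < y by move: r_gt0; rewrite /r muln_gt0 => /andP[].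
pose d := diamonds_per_row i; have d_gt0 : 0 < d by rewrite /d /diamonds_per_row addn2.
have a_lt : row_of z - o < r * (y %/ d).-1 by rewrite /r /d -/(strip i); lia.
pose j := (row_of z - o) %/ r.
have j_lt : j.+1 < y %/ d.
  by have : j < (y %/ d).-1; [rewrite ltn_divLR // mulnC | lia].
pose s := col_of z %/ (2 * r).
have s_lt : s.+1 < d.
  by rewrite /s /d /diamonds_per_row -/r addn2 !ltnS leq_div2r // ltnW ?col_of_lt.
have r2_gt0 : 0 < 2 * r by lia.
have [j' [s' [j'_le s'_le near]]] :=
  diamond_neighbors j r_gt0 (ltn_pmod (col_of z) r2_gt0) (ltn_pmod (row_of z - o) r_gt0).
have sd : s + s' < d by lia.
have rem_lt : j' * d + (s + s') < y.
  apply: leq_trans (leq_trunc_div y d); apply: leq_trans (_ : j'.+1 * d <= _).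
    by rewrite mulSn; lia.
  by rewrite leq_mul2r; apply/orP; right; lia.
exists (r + (j' * d + (s + s'))).
  by apply: leq_trans (_ : i.+1 * y <= _); [rewrite mulSn -/r; lia | rewrite leq_mul2r il orbT].
have i_eq : (r + (j' * d + (s + s'))) %/ y = i.
  by rewrite /r divnMDl // divn_small ?addn0.
have m_eq : (r + (j' * d + (s + s'))) %% y = j' * d + (s + s').
  by rewrite /r modnMDl modn_small.
rewrite /diamond_center i_eq m_eq -/d -/o -/r modnMDl (modn_small sd).
rewrite divnMDl // (divn_small sd) addn0.
apply: leq_trans (gdist_clamp_point _ _ _) _; apply: leq_trans (leq_addr _ _).
apply: leq_trans near.
have row_eq := divn_eq (row_of z - o) r; have col_eq := divn_eq (col_of z) (2 * r).
rewrite -/j mulnC in row_eq; rewrite -/s mulnC in col_eq.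
apply: leq_add.
  by rewrite -[row_of z in leqLHS](subnKC lo) adistDl {1}row_eq.
by rewrite {1}col_eq mulnDr -addnA adistDl.
Qed.

End DiamondCovering.

(** * The time needed once everything is revealed *)

Section BurningNumber.
Local Open Scope nat_scope.

(* All vertices are revealed in round [t.+1] at the latest. *)
Definition burn_time n x : Prop := forall k t, 0 < k -> n * n <= t.+1 * k ->
  win k (t + x) set0 (set0 : {set grid n}).

Lemma burn_time_diamond n y l : 0 < n -> n <= \sum_(i < l) strip n y i -> burn_time n (l * y).
Proof.
move=> n_gt0 nl k t k_gt0 nt; apply: (@win_all_revealed _ _ _ _ (diamond_center y n_gt0) nt).
by move=> z; apply: diamond_cover.
Qed.

Lemma burn_time_exists n : exists x, burn_time n x.
Proof.
case: n => [|n]; [exists 0 | exists (2 * n.+1)] => k t k_gt0 nt.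
  by apply: (@win_leq _ _ 0) => //; apply/setP => -[[]].
apply: (@win_all_revealed _ _ _ _ (fun=> (ord0, ord0)) nt) => z.
exists (2 * n.+1).-1; first by lia.
have := row_of_lt z; have := col_of_lt z; rewrite /gdist /adist.
by rewrite [row_of (_, _)]/row_of [col_of (_, _)]/col_of /=; lia.
Qed.

End BurningNumber.

(** * Bounds over the natural numbers *)

Section Bounds.
Local Open Scope nat_scope.

Lemma burning_le_win k (G : sgraph) j : win k j set0 (set0 : {set G}) ->
  liminal_burning_number k G <= j.
Proof. exact: game_value_win. Qed.

Lemma burning_le_size_win n k j : size_win n k j 0 -> liminal_burning_number k (grid n) <= j.
Proof. by move=> w0; apply/burning_le_win/w0; rewrite minn0. Qed.

Lemma burning_le_cooling (n k l : nat) : 0 < k -> n != 1 -> n != 5 -> 1 < l ->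
  2 ^ l <= n + 3 < 2 ^ l.+1 -> liminal_burning_number k (grid n) <= 2 * n - 2 * l + 2.
Proof.
move=> k_gt0 n1 n5 l_gt1 ln; apply: burning_le_size_win.
have l_ge := expn2_ge l_gt1.
have [n_gt2|] := ltnP 2 n; first by apply: size_win_cooling => //; lia.
move=> n_le; have n_eq : n = 2 by lia.
have l_eq : l = 2 by case: (l =P 2) => // l2; have := expn2_gt l_gt1 l2; lia.
by rewrite n_eq l_eq; have [] := small_cooling k_gt0.
Qed.

Lemma burning_le_cooling_log n k : 0 < k -> 0 < n -> n != 1 -> n != 5 ->
  liminal_burning_number k (grid n) + 2 * trunc_log 2 (n + 3) <= 2 * n + 2.
Proof.
move=> k_gt0 n_gt0 n1 n5; have /andP[lo hi] := trunc_log_bounds (isT : 1 < 2) (ltn0Sn (n + 2)).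
rewrite -addnS in lo hi; set l := trunc_log 2 (n + 3) in lo hi *.
have l_gt1 : 1 < l.
  rewrite ltnNge; apply/negP => l_le.
  by have := leq_trans hi (leq_pexp2l (isT : 0 < 2) (l_le : l.+1 <= 2)); lia.
have l_ge := expn2_ge l_gt1.
have := burning_le_cooling k_gt0 n1 n5 l_gt1; rewrite lo hi => /(_ isT).
have : l <= n by case: (l =P 2) => [->|l2]; [|have := expn2_gt l_gt1 l2]; lia.
by lia.
Qed.

Lemma burning_le_corner n k h : 2 * h + 2 <= n -> 3 < h -> h <= k -> 5 < k ->
  liminal_burning_number k (grid n) <= 2 * n - 2 - uphalf h.
Proof. by move=> *; apply/burning_le_win/win_corner_strategy. Qed.

Lemma burning_le_small_k n k : 1 < k -> 2 * k + 3 <= n ->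
  2 * liminal_burning_number k (grid n) + k + 4 <= 4 * n.
Proof.
move=> k_gt1 kn; have [k_le5|k_gt5] := leqP k 5; last first.
  by have := @burning_le_corner n k k; lia.
(* [n >= 7] makes the logarithm at least 3, enough for [k <= 4]; [k = 5] forces [n >= 13], where it
   is at least 4. *)
have := @burning_le_cooling_log n k; have [k_le4|k_gt4] := leqP k 4.
  have : 3 <= trunc_log 2 (n + 3) by apply: trunc_log_max => //; lia.
  by lia.
have : 4 <= trunc_log 2 (n + 3) by apply: trunc_log_max => //; lia.
by lia.
Qed.

Lemma burning_le_medium_k n k : 0 < k -> n < 2 * k + 3 -> 7 * k <= 4 * n ->
  4 * liminal_burning_number k (grid n) + 5 <= 7 * n.
Proof.
move=> k_gt0 nk kn; have [n_le12|n_gt12] := leqP n 12; last first.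
  by have := @burning_le_corner n k (n - 2)./2; lia.
have [/burning_le_size_win b2 /burning_le_size_win b4
      /burning_le_size_win b5 /burning_le_size_win b12] := small_cooling k_gt0.
have b l : 1 < l -> 2 ^ l <= n + 3 < 2 ^ l.+1 -> n != 1 -> n != 5 ->
    liminal_burning_number k (grid n) <= 2 * n - 2 * l + 2.
  by move=> l_gt1 ln n1 n5; apply: burning_le_cooling.
have n1 : n != 1 by lia.
have [n2|n2] := eqVneq n 2; first by subst n; lia.
have [n4|n4] := eqVneq n 4; first by subst n; lia.
have [n5|n5] := eqVneq n 5; first by subst n; lia.
have [n12|n12] := eqVneq n 12; first by subst n; lia.
have [n_lt5|n_ge5] := ltnP n 5.
  by have := b 2 isT _ n1 n5; lia.
by have := b 3 isT _ n1 n5; lia.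
Qed.

Lemma burning_le_all_revealed n k x : 0 < n -> 0 < k -> burn_time n x ->
  exists2 t, t * k <= n * n & liminal_burning_number k (grid n) <= t + x.
Proof.
move=> n_gt0 k_gt0 bx; exists (n * n %/ k); first exact: leq_trunc_div.
by apply/burning_le_win/bx => //; apply/ltnW/ltn_ceil.
Qed.

Lemma burning_le_tiling n k w q : 0 < n -> 0 < k -> k <= w * w ->
  n <= q * w ->
  exists t e, [/\ t * k <= n * n, t * k + e * (w * w) <= q * q * (w * w) &
    liminal_burning_number k (grid n) <= t + maxn (2 * w.-1) (e + w)].
Proof.
(* The least [t] with [n * n <= t.+1 * k]. *)
move=> n_gt0 k_gt0 kw nqw; set t := (n * n).-1 %/ k.
have w2_gt0 : 0 < w * w by apply: leq_trans k_gt0 kw.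
have tk : t * k <= (n * n).-1 by apply: leq_trunc_div.
have nn : n * n <= t.+1 * k.
  have nn_gt0 : 0 < n * n by rewrite muln_gt0 n_gt0.
  by have := ltn_ceil (n * n).-1 k_gt0; rewrite -/t; lia.
have nq : n * n <= q * q * (w * w) by have := leq_mul nqw nqw; rewrite mulnACA.
set e := (q * q * (w * w) - t * k) %/ (w * w); exists t, e; split.
- by lia.
- by rewrite -leq_subRL ?leq_trunc_div //; lia.
apply/burning_le_win/(@win_grid_tiling _ _ w q n_gt0 k_gt0 kw nqw t e) => //.
- by rewrite -ltn_subLR ?ltn_ceil //; lia.
- exact: leq_maxl.
by rewrite leq_max leq_add2l; apply/orP; right; lia.
Qed.

Lemma ceil_sqrt_exists k : 0 < k -> exists w, [/\ 0 < w, k <= w * w & w.-1 * w.-1 < k].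
Proof.
move=> k_gt0; have exw : exists w, k <= w * w by exists k; rewrite leq_pmulr.
case: (ex_minnP exw) => w kw w_min; have w_gt0 : 0 < w by case: (w) kw => //; lia.
by exists w; split=> //; rewrite ltnNge; apply/negP => /w_min; lia.
Qed.

Lemma ceil_div_exists n w : 0 < w -> exists q, n <= q * w <= n + w.
Proof.
move=> w_gt0; exists ((n + w.-1) %/ w).
have := ltn_ceil (n + w.-1) w_gt0; have := leq_trunc_div (n + w.-1) w.
by rewrite mulSn; move: (_ * w) => m; lia.
Qed.

End Bounds.

(* Real estimates and the five cases *)
From mathcomp Require Import all_classical all_reals all_analysis.

Import Order.TTheory GRing.Theory Num.Theory.
Import numFieldNormedType.Exports.

Local Open Scope classical_set_scope.
Local Open Scope ring_scope.

Lemma sum_strip_ge (R : realFieldType) n y l :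
  2 * (y * l)%:R ^+ 3 * (1 - 3 / 2 / l%:R) / 3 <=
  ((\sum_(i < l) strip n y i)%N%:R + (y * l)%:R * l%:R) * (n%:R + 4 * (y * l)%:R) :> R.
Proof.
have [->|l_gt0] := posnP l; first by rewrite big_ord0 muln0; lra.
set W : R := n%:R + _.
have step i : (i < l)%N -> 2 * y%:R ^+ 3 * i%:R ^+ 2 <=
    ((strip n y i)%:R + 2 * i%:R * y%:R) * W :> R.
  move=> il; have := strip_ge n y i; rewrite -(ler_nat R) !(natrM, natrD, natrX) => h.
  have -> : 2 * y%:R ^+ 3 * i%:R ^+ 2 = 2 * (i%:R * y%:R) ^+ 2 * y%:R :> R by ring.
  apply: le_trans h _; rewrite mulrA.
  apply: ler_wpM2l; first by rewrite addr_ge0 // !mulr_ge0.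
  rewrite /W lerD2l ler_pM2l ?ltr0n // natrM mulrC ler_wpM2l // ler_nat; exact: ltnW.
have sums m : 2 * y%:R ^+ 3 * (m%:R ^+ 3 / 3 - m%:R ^+ 2 / 2) <=
    2 * y%:R ^+ 3 * \sum_(i < m) i%:R ^+ 2 :> R.
  elim: m => [|m IHm]; first by rewrite big_ord0; lra.
  rewrite big_ord_recr /= [leRHS]mulrDr; apply: le_trans _ (lerD IHm (lexx _)).
  have y3 : 0 <= y%:R ^+ 3 :> R by apply: exprn_ge0.
  rewrite -mulrDr ler_wpM2l ?mulr_ge0 // -[m.+1]addn1 natrD; nra.
have suml m : \sum_(i < m) 2 * i%:R * y%:R <= y%:R * m%:R ^+ 2 :> R.
  elim: m => [|m IHm]; first by rewrite big_ord0; lra.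
  rewrite big_ord_recr /= -[m.+1]addn1 natrD.
  have y0 : 0 <= y%:R :> R by []. have m0 : 0 <= m%:R :> R by [].
  by nra.
have l_neq0 : l%:R != 0 :> R by rewrite pnatr_eq0 -lt0n.
have -> : 2 * (y * l)%:R ^+ 3 * (1 - 3 / 2 / l%:R) / 3 =
    2 * y%:R ^+ 3 * (l%:R ^+ 3 / 3 - l%:R ^+ 2 / 2) :> R.
  by rewrite natrM; field.
apply: le_trans (sums l) _; rewrite mulr_sumr.
apply: le_trans (_ : \sum_(i < l) ((strip n y i)%:R + 2 * i%:R * y%:R) * W <= _).
  by apply: ler_sum => i _; apply: step.
rewrite -mulr_suml big_split /= natr_sum; apply: ler_wpM2r.
  by rewrite /W addr_ge0 // mulr_ge0.
by rewrite lerD2l natrM -mulrA -expr2; apply: suml.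
Qed.

(** For [x = l * y] the strips have total height about [2 / 3 * x ^ 3 / n], which reaches [n] when
    [x ^ 3 = 3 / 2 * n ^ 2]; hence the constant [a]. Writing [n = c ^ 3] avoids fractional
    powers. *)
Lemma burn_time_asymptotic (R : realType) (a d : R) : 0 < a -> a ^+ 3 = 3 / 2 ->
  0 < d <= 1 -> exists c0, forall (n : nat) (c : R), c0 <= c -> n%:R = c ^+ 3 ->
  exists2 x, burn_time n x & x%:R <= (1 + d) * a * c ^+ 2.
Proof.
move=> a_gt0 a3 /andP[d_gt0 d_le1].
(* Bounds the relative loss [3 / 2 / l] of [sum_strip_ge] by [d / 4]. *)
pose l := (Num.truncn (6 / d)).+4; have l_ge : 6 / d <= l%:R.
  have : 0 <= 6 / d by rewrite divr_ge0 // ltW.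
  move/truncn_itv => /andP[_ /ltW lt]; apply: le_trans lt _.
  by rewrite ler_nat /l; lia.
have l_ge4 : 4 <= l%:R :> R by rewrite (ler_nat _ 4).
have l_gt0 : 0 < l%:R :> R by lra.
exists (24 * l%:R / d) => n c c_ge n_eq.
have a_ge1 : 1 <= a by rewrite leNgt; apply/negP => a_lt; nra.
have a_le : a <= 3 / 2 by rewrite leNgt; apply/negP => a_lt; nra.
have c_d : 24 * l%:R <= d * c by move: c_ge; rewrite ler_pdivrMr // [c * d]mulrC.
have c_gt : 96 <= c by nra.
have n_gt0 : (0 < n)%N by rewrite -(ltr0n R) n_eq exprn_gt0 //; lra.
have c2_gt0 : 0 < c ^+ 2 by apply: exprn_gt0; lra.
have ac2_gt0 : 0 < a * c ^+ 2 by apply: mulr_gt0.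
pose X := (1 + d) * a * c ^+ 2.
have X_ge0 : 0 <= X by rewrite /X !mulr_ge0 ?exprn_ge0 //; lra.
pose y := Num.truncn (X / l%:R).
have /andP[y_le y_gt] : y%:R <= X / l%:R < y.+1%:R.
  by apply/truncn_itv/divr_ge0 => //; exact: ltW.
rewrite ler_pdivlMr // in y_le; rewrite ltr_pdivrMr // -addn1 natrD in y_gt.
exists (l * y)%N; last by rewrite natrM mulrC.
(* Were the strips lower than [n], the right side of [sum_strip_ge] would be at most
   [((1 + d / 8) * c ^ 3) ^ 2] and the left side larger. *)
apply: burn_time_diamond => //; rewrite leqNgt; apply/negP => S_lt.
have := sum_strip_ge R n y l; apply/negP; rewrite -ltNge.
have S_le : (\sum_(i < l) strip n y i)%N%:R <= n%:R :> R by rewrite ler_nat ltnW.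
set x : R := (y * l)%:R; have xE : x = y%:R * l%:R by rewrite /x natrM.
have x_le : x <= 2 * a * c ^+ 2.
  by rewrite xE; apply: le_trans y_le _; rewrite /X -!mulrA ler_wpM2r ?(ltW ac2_gt0) //; lra.
have x_ge : (1 + d / 2) * a * c ^+ 2 <= x.
  have : X < x + l%:R by rewrite xE; lra.
  have : l%:R <= d / 2 * a * c ^+ 2.
    have ac_ge : 1 <= a * c by nra.
    have : 24 * l%:R * 1 <= d * c * (a * c) by apply: ler_pM => //; lra.
    by rewrite (_ : d / 2 * a * c ^+ 2 = d * c * (a * c) / 2); [lra | field].
  by rewrite /X; lra.
have c6_gt0 : 0 < c ^+ 6 by apply: exprn_gt0; lra.
have lc_le : 3 * l%:R * c ^+ 2 <= d / 8 * c ^+ 3.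
  by rewrite [c ^+ 3]exprS mulrA ler_wpM2r ?(ltW c2_gt0) //; lra.
have x_le' : x <= 3 * c ^+ 2 by apply: le_trans x_le _; rewrite ler_wpM2r ?(ltW c2_gt0) //; lra.
apply: le_lt_trans (_ : ((1 + d / 8) * c ^+ 3) ^+ 2 < _).
  have x_ge0 : 0 <= x by rewrite /x.
  rewrite expr2; apply: ler_pM.
  - by apply: addr_ge0 => //; apply: mulr_ge0 => //; apply: ltW.
  - by rewrite addr_ge0 // mulr_ge0.
  - have : x * l%:R <= 3 * c ^+ 2 * l%:R by rewrite ler_wpM2r // ltW.
    by rewrite -/x; lra.
  have : 4 * c ^+ 2 <= l%:R * c ^+ 2 by rewrite ler_wpM2r // ltW.
  by lra.
have x3 : (1 + d / 2) ^+ 3 * (3 / 2) * c ^+ 6 <= x ^+ 3.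
  rewrite -a3 (_ : _ * _ * _ = ((1 + d / 2) * a * c ^+ 2) ^+ 3); last by ring.
  have base_ge0 : 0 <= (1 + d / 2) * a * c ^+ 2.
    by rewrite -mulrA; apply: mulr_ge0; [lra | apply: ltW].
  by rewrite lerXn2r // nnegrE // (le_trans base_ge0).
have l_inv : 3 / 2 / l%:R <= d / 4.
  by rewrite ler_pdivrMr //; move: l_ge; rewrite ler_pdivrMr //; lra.
apply: lt_le_trans (_ : 2 * ((1 + d / 2) ^+ 3 * (3 / 2) * c ^+ 6) * (1 - d / 4) / 3 <= _).
  have -> : 2 * ((1 + d / 2) ^+ 3 * (3 / 2) * c ^+ 6) * (1 - d / 4) / 3 =
            (1 + d / 2) ^+ 3 * (1 - d / 4) * c ^+ 6 by field.
  have -> : ((1 + d / 8) * c ^+ 3) ^+ 2 = (1 + d / 8) ^+ 2 * c ^+ 6 by ring.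
  by rewrite ltr_pM2r //; nra.
rewrite ler_pM2r ?invr_gt0 //; apply: ler_pM; [|by lra| |by lra].
  apply: mulr_ge0 => //; apply: mulr_ge0; [apply: mulr_ge0; last by [] | exact: ltW].
  by apply: exprn_ge0; lra.
by rewrite ler_pM2l.
Qed.

(** Here [s] is the square root of [k], [W] its ceiling, [Q] the number of tiles per side, [T] the
    number of rounds before the full reveal, and [E] bounds the number of tiles without fire. *)
Lemma tiling_rounds_le (R : realFieldType) (N s W Q T E b : R) :
  0 < N -> 1 < s -> 0 <= Q -> 0 <= T -> s ^+ 3 < 3 / 16 * N ^+ 2 ->
  s <= W < s + 1 -> Q * W <= N + W -> T * s ^+ 2 <= N ^+ 2 ->
  T * s ^+ 2 + E * W ^+ 2 <= Q ^+ 2 * W ^+ 2 ->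
  b <= T + 2 * (W - 1) \/ b <= T + E + W ->
  b <= N ^+ 2 / (s ^+ 2 - 2 * s + 1) + 2 * s - 3.
Proof.
move=> N_gt0 s_gt1 Q_ge0 T_ge0 sN /andP[sW Ws] QW Ts TE bb.
have s_gt0 : 0 < s by lra.
have W_gt0 : 0 < W by lra.
have [y yE] : exists y, N = y * s by exists (N / s); rewrite divfK // gt_eqF.
have [v vE] : exists v, N = v * W by exists (N / W); rewrite divfK // gt_eqF.
have [r rE] : exists r, s = r * W by exists (s / W); rewrite divfK // gt_eqF.
have y_gt0 : 0 < y by rewrite -(pmulr_lgt0 _ s_gt0) -yE.
have v_gt0 : 0 < v by rewrite -(pmulr_lgt0 _ W_gt0) -vE.
have r_gt0 : 0 < r by rewrite -(pmulr_lgt0 _ W_gt0) -rE.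
have r_le1 : r <= 1 by rewrite -(ler_pM2r W_gt0) -rE mul1r.
have yr : y * r = v by apply: (mulIf (lt0r_neq0 W_gt0)); rewrite -mulrA -rE -yE.
have y2 : 16 / 3 * s < y ^+ 2.
  have : s ^+ 2 * s < s ^+ 2 * (3 / 16 * y ^+ 2) by move: sN; rewrite yE; lra.
  by rewrite ltr_pM2l ?exprn_gt0 //; lra.
have den : y ^+ 2 + 2 * y ^+ 2 / s <= N ^+ 2 / (s ^+ 2 - 2 * s + 1).
  have s1 : 0 < (s - 1) ^+ 2 by apply: exprn_gt0; lra.
  rewrite (_ : s ^+ 2 - 2 * s + 1 = (s - 1) ^+ 2); last by ring.
  rewrite ler_pdivlMr // yE [leLHS](_ : _ = y ^+ 2 * ((1 + 2 / s) * (s - 1) ^+ 2)); last by ring.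
  rewrite exprMn ler_wpM2l ?exprn_ge0 ?ltW //.
  rewrite (_ : (1 + 2 / s) * _ = s ^+ 2 - 3 + 2 / s); last by field; rewrite gt_eqF.
  have : 2 / s <= 2 by rewrite ler_pdivrMr //; lra.
  by lra.
have T_le : T <= y ^+ 2.
  by move: Ts; rewrite yE exprMn ler_pM2r // exprn_gt0.
apply: le_trans (_ : y ^+ 2 + 2 * y ^+ 2 / s + 2 * s - 3 <= _); last by lra.
have ys : 16 / 3 < y ^+ 2 / s by rewrite ltr_pdivlMr.
case: bb => bb; apply: le_trans bb _; first by lra.
have v_le : v <= y by rewrite -yr -[leRHS]mulr1 ler_pM2l.
have Q_le : Q <= v + 1.
  by rewrite -(ler_pM2r W_gt0) mulrDl mul1r -vE.
have E_le : E <= Q ^+ 2 - T * r ^+ 2.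
  have W2 : 0 < W ^+ 2 by apply: exprn_gt0.
  rewrite -(ler_pM2r W2) mulrBl.
  by move: TE; rewrite {1}rE exprMn mulrA; lra.
have Q2 : Q ^+ 2 <= (v + 1) ^+ 2 by rewrite lerXn2r // nnegrE; lra.
have r2_le1 : r ^+ 2 <= 1 by rewrite expr_le1 // ltW.
have yr2 : y ^+ 2 * r ^+ 2 = v ^+ 2 by rewrite -exprMn yr.
have Tr : T * (1 - r ^+ 2) <= y ^+ 2 * (1 - r ^+ 2) by rewrite ler_wpM2r //; lra.
(* One [y ^+ 2 / s] gives [2 * y] by the arithmetic-geometric mean inequality with [s]; the other
   exceeds [16 / 3]. *)
have fin : 2 * y + 5 <= s + 2 * (y ^+ 2 / s).
  rewrite -(ler_pM2r s_gt0) [leRHS](_ : _ = s ^+ 2 + 2 * y ^+ 2); last by field; rewrite gt_eqF.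
  have : 0 <= (s - y) ^+ 2 by apply: sqr_ge0.
  by lra.
by lra.
Qed.

Theorem theorem22 (R : realType) :
  exists o : nat -> R,
    o x @[x --> \oo] --> 0 /\
    forall n k : nat, (0 < n)%N -> (0 < k)%N ->
    let b : R := (liminal_burning_number k (grid n))%:R in
    let N : R := n%:R in
    let K : R := k%:R in
    [/\ k = 1%N -> n <> 1%N -> n <> 5%N ->
          b <= 2 * N - 2 * (trunc_log 2 (n + 3))%:R + 2,
        2 <= K <= (N - 3) / 2 ->
          b <= 2 * N - K / 2 - 2,
        (N - 3) / 2 < K <= 4 * N / 7 ->
          b <= 7 * N / 4 - 5 / 4,
        4 * N / 7 < K < (3 / 16) `^ (2 / 3) * N `^ (4 / 3) ->
          b <= N ^+ 2 / (K - 2 * Num.sqrt K + 1) + 2 * Num.sqrt K - 3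
      & (3 / 16) `^ (2 / 3) * N `^ (4 / 3) <= K ->
          b <= N ^+ 2 / K + (1 + o n) * (3 / 2) `^ (1 / 3) * N `^ (2 / 3)].
Proof.
(* The optimal burning time does not involve [k], so [o] is a function of [n] alone. *)
have [beta beta_time beta_min] : exists2 beta : nat -> nat,
    forall n, burn_time n (beta n) & forall n x, burn_time n x -> (beta n <= x)%N.
  have ex n : exists x, `[< burn_time n x >].
    by have [x /asboolP bx] := burn_time_exists n; exists x.
  exists (fun n => ex_minn (ex n)) => [n|n x bx]; case: ex_minnP => m.
    by move=> /asboolP.
  by move=> _; apply; apply/asboolP.
pose a : R := (3 / 2) `^ (1 / 3).
have a_gt0 : 0 < a by apply: powR_gt0; lra.
have powR3 (x p : R) : (x `^ p) ^+ 3 = x `^ (p * 3) by rewrite -powR_mulrn ?powR_ge0 // -powRrM.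
have cube (x : R) : 0 <= x -> (x `^ (1 / 3)) ^+ 3 = x.
  by move=> x_ge0; rewrite powR3 divfK // powRr1.
have a3 : a ^+ 3 = 3 / 2 by apply: cube; lra.
have sq (x : R) : x `^ (2 / 3) = (x `^ (1 / 3)) ^+ 2.
  by rewrite -powR_mulrn ?powR_ge0 // -powRrM; congr (_ `^ _); field.
have quart (x : R) : x `^ (4 / 3) = (x `^ (1 / 3)) ^+ 4.
  by rewrite -powR_mulrn ?powR_ge0 // -powRrM; congr (_ `^ _); field.
(* The relative excess of [beta n], so the last bound holds by construction; cutting at 0 leaves
   only an upper estimate for the limit. *)
pose o n : R := Num.max 0 ((beta n)%:R / (a * n%:R `^ (2 / 3)) - 1).
exists o; split.
  apply/cvgr0Pnorm_lt => eps eps_gt0.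
  pose d := Num.min 1 (eps / 2).
  have d_bnd : 0 < d <= 1 by rewrite lt_min ge_min lexx ltr01 divr_gt0.
  have [c0 c0P] := burn_time_asymptotic a_gt0 a3 d_bnd.
  near=> n.
  have n_gt0 : (0 < n)%N by near: n; exists 1%N.
  have N_gt0 : 0 < n%:R :> R by rewrite ltr0n.
  pose c : R := n%:R `^ (1 / 3).
  have c_gt0 : 0 < c by apply: powR_gt0.
  have c0_le : Num.max 0 c0 ^+ 3 <= n%:R by near: n; exact: nbhs_infty_ger.
  have c_ge : c0 <= c.
    have c3 : c ^+ 3 = n%:R by apply: cube; apply: ltW.
    have : Num.max 0 c0 <= c.
      by rewrite -(ler_pXn2r (ltn0Sn 2)) ?c3 // nnegrE ?(ltW c_gt0) // le_max lexx.
    by rewrite ge_max => /andP[].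
  have [x bx x_le] := c0P n c c_ge (esym (cube _ (ltW N_gt0))).
  have o_le : o n <= d.
    rewrite /o ge_max ltW ?(andP d_bnd).1 //= lerBlDr sq -/c.
    rewrite ler_pdivrMr ?mulr_gt0 ?exprn_gt0 // mulrA [d + 1]addrC.
    by apply: le_trans x_le; rewrite ler_nat; apply: beta_min.
  have o_ge : 0 <= o n by rewrite /o le_max lexx.
  rewrite ger0_norm //; apply: le_lt_trans o_le _.
  by rewrite gt_min; apply/orP; right; lra.
move=> n k n_gt0 k_gt0 b N K.
have N_gt0 : 0 < N by rewrite ltr0n.
have K_gt0 : 0 < K by rewrite ltr0n.
pose c : R := N `^ (1 / 3).
have c_gt0 : 0 < c by apply: powR_gt0.
have c3 : c ^+ 3 = N by apply: cube; apply: ltW.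
split.
- move=> _ n1 n5; have := burning_le_cooling_log k_gt0 n_gt0 (introN eqP n1) (introN eqP n5).
  by rewrite -(ler_nat R) !(natrM, natrD) -/b -/N; lra.
- move=> /andP[k2 kn]; have : (2 * liminal_burning_number k (grid n) + k + 4 <= 4 * n)%N.
    apply: burning_le_small_k; first by rewrite -(ler_nat R).
    by rewrite -(ler_nat R) !(natrM, natrD) -/N -/K; lra.
  by rewrite -(ler_nat R) !(natrM, natrD) -/b -/N -/K; lra.
- move=> /andP[kn k7]; have : (4 * liminal_burning_number k (grid n) + 5 <= 7 * n)%N.
    apply: burning_le_medium_k => //.
      by rewrite -(ltr_nat R) !(natrM, natrD) -/N -/K; lra.
    by rewrite -(ler_nat R) !natrM -/N -/K; lra.
  by rewrite -(ler_nat R) !(natrM, natrD) -/b -/N; lra.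
- move=> /andP[kn kN]; pose s := Num.sqrt K.
  have s_ge0 : 0 <= s by apply: sqrtr_ge0.
  have s2 : s ^+ 2 = K by apply: sqr_sqrtr; apply: ltW.
  pose e : R := (3 / 16) `^ (1 / 3).
  have e_gt0 : 0 < e by apply: powR_gt0; lra.
  have e3 : e ^+ 3 = 3 / 16 by apply: cube; lra.
  have s_lt : s < e * c ^+ 2.
    have ec : 0 < e * c ^+ 2 by rewrite mulr_gt0 ?exprn_gt0.
    rewrite -(ltr_pXn2r (ltn0Sn 1)) ?nnegrE ?(ltW ec) // s2.
    by move: kN; rewrite sq quart -/e -/c; lra.
  have s3 : s ^+ 3 < 3 / 16 * N ^+ 2.
    have -> : 3 / 16 * N ^+ 2 = (e * c ^+ 2) ^+ 3 by rewrite -e3 -c3; ring.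
    by rewrite ltr_pXn2r // nnegrE // (le_trans s_ge0) // ltW.
  have s_gt1 : 1 < s.
    (* For [k = 1] the range forces [n = 1], which contradicts [s3]. *)
    have k_gt1 : (1 < k)%N.
      rewrite ltnNge; apply/negP => k_le1; have k1 : k = 1%N by apply/eqP; rewrite eqn_leq k_le1.
      have n1 : n = 1%N.
        have : (4 * n < 7)%N by rewrite -(ltr_nat R) natrM -/N; move: kn; rewrite /K k1; lra.
        by move: n_gt0; clear; lia.
      by move: s3; rewrite /s /K /N k1 n1 sqrtr1; lra.
    by rewrite -(ltr_pXn2r (ltn0Sn 1)) ?nnegrE // s2 expr1n ltr1n.
  have [w [w_gt0 kw wk]] := ceil_sqrt_exists k_gt0.
  have [q /andP[nq qn]] := ceil_div_exists n w_gt0.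
  have [t [f [tk tf bt]]] := burning_le_tiling n_gt0 k_gt0 kw nq.
  rewrite -/s -s2; apply: (@tiling_rounds_le _ N s w%:R q%:R t%:R f%:R) => //.
  + apply/andP; split.
      by rewrite -(ler_pXn2r (ltn0Sn 1)) ?nnegrE // s2 -natrX ler_nat expnS expn1.
    rewrite -ltrBlDr -(natrB _ w_gt0) subn1 -(ltr_pXn2r (ltn0Sn 1)) ?nnegrE //.
    by rewrite s2 -natrX ltr_nat -mulnn.
  + by rewrite /N -!natrM -natrD ler_nat.
  + by rewrite s2 -natrM /N -natrX ler_nat expnS expn1.
  + by rewrite s2 -!natrX -!natrM -natrD ler_nat -!mulnn.
  move: bt; rewrite addn_maxr leq_max -!(ler_nat R) => /orP[bt|bt]; [left|right].
    by move: bt; rewrite natrD natrM -subn1 natrB.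
  by move: bt; rewrite !natrD addrA.
move=> _; have [t tk bt] := burning_le_all_revealed n_gt0 k_gt0 (beta_time n).
apply: le_trans (_ : t%:R + (beta n)%:R <= _); first by rewrite -natrD ler_nat.
apply: lerD; first by rewrite ler_pdivlMr // -natrX -natrM ler_nat.
have ac : 0 < a * N `^ (2 / 3) by rewrite mulr_gt0 // powR_gt0.
rewrite -mulrA -ler_pdivrMr // -lerBlDl /o le_max -/N lexx orbT //.
Unshelve. all: by end_near.
Qed.
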